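(* Let $\mathbb{F}_q$ be the finite field with $q$ elements, $d\ge 2$, $t\in\mathbb{F}_q\setminus\{0\}$, $E\subseteq\mathbb{F}_q^d$. Fix a tree $T$ with $r+1$ vertices (hence $r$ edges) and let $\varepsilon>0$. If $|E|>q^{\frac{d+1}{2}+\varepsilon}$, then there is a subset $E'\subseteq E$ with $$|E\setminus E'|\le 2q^{-\frac{2\varepsilon}{r+1}}|E|$$ such that, if $n_T$ denotes the number of embeddings of $T$ into $\mathcal{G}^{dist}_t(E')$, then $$\left|n_T-\frac{|E|^{r+1}}{q^r}\right|\le 8\frac{|E|^{r+1}}{q^r}q^{-\frac{2\varepsilon}{r+1}}.$$ The same is true with $\mathcal{G}^{dist}_t$ replaced by $\mathcal{G}^{prod}_t$.
   Context: For $x\in\mathbb{F}_q^d$, $\|x\|=x_1^2+\dots+x_d^2$ and $x\cdot y=\sum_i x_iy_i$. For $A\subseteq\mathbb{F}_q^d$, $\mathcal{G}^{dist}_t(A)$ is the graph with vertex set $A$ where $x,y$ are adjacent iff $\|x-y\|=t$, and $\mathcal{G}^{prod}_t(A)$ is the graph with vertex set $A$ where $x,y$ are adjacent iff $x\cdot y=t$. An embedding of $T$ into a graph $G$ means an edge-preserving map $\sigma$ from the vertex set of $T$ to the vertex set of $G$ (i.e. $\sigma(u),\sigma(v)$ adjacent in $G$ whenever $u,v$ are adjacent in $T$).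
   Formalization: The distance-graph part is stated only for odd q: for even q, ‖x−y‖ is (Σ(x_i−y_i))² and the claim fails, e.g. d=5, E={Σx_i=0}, ε=1/2, T a single edge, q=128; the product-graph part is for all q. *)

(* Defs.v *)
From mathcomp Require Import all_boot all_order all_algebra.

Set Implicit Arguments.
Unset Strict Implicit.
Unset Printing Implicit Defensive.

Import GRing.Theory.
Local Open Scope ring_scope.

(* A cycle is a duplicate-free closed walk of length at least 3: for a
   symmetric e, every edge is already a ucycle of length 2. *)
Definition is_tree (T : finType) (e : rel T) : Prop :=
  [/\ symmetric e,
      irreflexive e,
      forall x y : T, connect e x y
    & forall c : seq T, ucycle e c -> (size c <= 2)%N].

(* In characteristic 2 this is (\sum_i x 0 i) ^+ 2, a degenerate form. *)
Definition sqnorm (F : finFieldType) (d : nat) (x : 'rV[F]_d) : F :=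
  \sum_(i < d) x 0 i ^+ 2.

Definition dotprod (F : finFieldType) (d : nat) (x y : 'rV[F]_d) : F :=
  \sum_(i < d) x 0 i * y 0 i.

(* The vertex type {x | x \in A} makes A itself the vertex set. *)
Definition dist_graph (F : finFieldType) (d : nat) (t : F)
    (A : {set 'rV[F]_d}) : rel {x | x \in A} :=
  fun x y => sqnorm (val x - val y) == t.

(* A vertex x with dotprod x x = t carries a loop. *)
Definition prod_graph (F : finFieldType) (d : nat) (t : F)
    (A : {set 'rV[F]_d}) : rel {x | x \in A} :=
  fun x y => dotprod (val x) (val y) == t.

(* Embeddings are edge-preserving maps, not required to be injective. *)
Definition num_embeddings (T G : finType) (eT : rel T) (eG : rel G) : nat :=
  #|[set s : {ffun T -> G} |
      [forall u, forall v, eT u v ==> eG (s u) (s v)]]|.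

(* Main.v *)
(** For every set B of vertices, the degrees into B satisfy
    sum_x (q deg_B(x) - |B|)^2 <= 4 q^(d+1) |B|.
    For the product graph this is a second moment computation with additive
    characters.  For the distance graph it is Parseval's identity, once the Fourier
    coefficients of the graph are bounded; they are Gauss sums times a Salie sum
    (d odd) or a Kloosterman sum K (d even), so one needs |K| <= 2 sqrt q.
    If this failed over F_q, the relation K_2 = 2 q - K^2 between the sums over a field
    and its quadratic extension would make |K| / sqrt q unbounded along a tower of
    quadratic extensions, whereas counting the points of X + c / X = y^q - y + b by
    the Stepanov-Bombieri method shows that this ratio is bounded along the tower.

    Let E' consist of the points of E of degree at most (1 + delta) |E| / q in E.  The
    discrepancy bound shows that few points are removed.  Growing the tree one leaf at a
    time, each new leaf multiplies the number of embeddings into E' by |E'| / q, up to an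
    error which is the product of the degree deviation and of the maximal number of
    embeddings with one prescribed vertex. *)

Require Import Defs.
From HB Require Import structures.
From mathcomp Require Import all_boot all_order all_algebra all_fingroup all_field all_character.
From mathcomp Require Import reals sequences exp ring lra zify.

Set Implicit Arguments.
Unset Strict Implicit.
Unset Printing Implicit Defensive.

Import Order.TTheory GRing.Theory Num.Theory.
Local Open Scope ring_scope.

(** * Square roots and additive characters of finite fields *)

(** The second moment controls the degrees only on average, while copies of a tree weigh a vertex by
    high powers of its degree (think of stars). This is why vertices of large degree must be removed
    before anything is counted. With lambda = q^(-2 eps / (r+1)), the hypothesis on |E| makes the
    total degree deviation at most 2 lambda^((r+1)/2) |E|^2 / q. The threshold delta = 3 lambda / r
    balances two demands: (1 + delta)^r must stay below 1 + 8 lambda, and the vertices above the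
    threshold must be at most 2 lambda |E|. For Kloosterman sums the point count may be crude: a
    bound C sqrt(q') along the tower is enough, with C depending on the starting field, since an
    excess delta over the constant 4 is multiplied by 4 at each quadratic extension. Hence the
    exponent in y^q - y stays that of the starting field, while the size of the field grows and is a
    perfect square, as the Stepanov argument requires. The distance graph needs q odd, since squares
    are completed throughout. *)

Lemma card_sum_fibers (A B : finType) (P : pred A) (f : A -> B) :
  #|P| = (\sum_b #|[set a | P a & f a == b]|)%N.
Proof.
rewrite -sum1_card (partition_big f predT) //=.
by apply: eq_bigr => b _; rewrite -sum1dep_card.
Qed.

Section SquareRoots.
Variable F : finFieldType.

Definition nsqrt (x : F) : nat := #|[set v : F | v ^+ 2 == x]|.

Lemma sum_nsqrt : (\sum_x nsqrt x)%N = #|F|.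
Proof. by rewrite [RHS](card_sum_fibers _ (fun v : F => v ^+ 2)). Qed.

Lemma nsqrt0 : nsqrt 0 = 1%N.
Proof.
rewrite /nsqrt (_ : [set _ | _] = [set 0]) ?cards1 //.
by apply/setP => v; rewrite !inE sqrf_eq0.
Qed.

Lemma nsqrt_le2 x : (nsqrt x <= 2)%N.
Proof.
rewrite /nsqrt; have [->|[v]] := set_0Vmem [set v : F | v ^+ 2 == x].
  by rewrite cards0.
rewrite inE => /eqP <-; rewrite (leq_trans _ (_ : #|[set v; - v]| <= 2)%N) //.
  by apply: subset_leq_card; apply/subsetP => u; rewrite !inE eqf_sqr.
by rewrite cards2; case: (_ != _).
Qed.

Lemma nsqrt_gt0P x : reflect (exists v, v ^+ 2 = x) (0 < nsqrt x)%N.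
Proof.
apply: (iffP card_gt0P) => -[v]; first by rewrite inE => /eqP <-; exists v.
by move=> <-; exists v; rewrite inE.
Qed.

Lemma nsqrtM2 x b : b != 0 -> nsqrt (x * b ^+ 2) = nsqrt x.
Proof.
move=> nzb; rewrite /nsqrt -[RHS](card_imset _ (mulIf nzb)); congr #|pred_of_set _|.
apply/setP => v; rewrite !inE; apply/idP/imsetP => [/eqP e|[u]].
  by exists (v / b); rewrite ?mulfVK // inE expr_div_n e mulfK // expf_neq0.
by rewrite inE => /eqP <- ->; rewrite exprMn.
Qed.

(* The two counts never add up to more than 2, and they add up to 2 on average. *)
Lemma nsqrt_nonsquare m x : nsqrt m = 0%N -> (nsqrt x + nsqrt (m * x)%R = 2)%N.
Proof.
move=> m0.
have nzm : m != 0 by apply: contra_eq_neq m0 => ->; rewrite nsqrt0.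
have le2 y : (nsqrt y + nsqrt (m * y)%R <= 2)%N.
  have [->|nzy] := eqVneq y 0; first by rewrite mulr0 nsqrt0.
  have [/nsqrt_gt0P[v vy]|] := boolP (0 < nsqrt y)%N; last first.
    by rewrite -eqn0Ngt => /eqP ->; apply: nsqrt_le2.
  suff -> : nsqrt (m * y) = 0%N by rewrite addn0 nsqrt_le2.
  by rewrite -vy nsqrtM2 //; apply: contra_neq nzy => v0; rewrite -vy v0 expr0n.
have sumM : (\sum_y nsqrt (m * y)%R = #|F|)%N.
  by rewrite -sum_nsqrt [RHS](reindex_inj (mulfI nzm)).
have := leqif_sum (I := F) (P := predT) (fun y _ => leqif_eq (le2 y)).
rewrite big_split /= sum_nsqrt sumM sum_nat_const muln2 addnn => -[_].
by rewrite eqxx => /esym/forallP/(_ x)/eqP.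
Qed.

(** If every element had a root, the total count [#|F|] would force exactly one root each, but 1 has
    the two roots 1 and -1. *)
Lemma exists_nonsquare : (2%:R : F) != 0 -> exists m, nsqrt m = 0%N.
Proof.
move=> nz2.
have [/forallP h|/forallPn[m]] := boolP [forall m, 0 < nsqrt m]%N; last first.
  by rewrite lt0n negbK => /eqP; exists m.
have := leqif_sum (I := F) (P := predT) (fun y _ => leqif_eq (h y)).
rewrite sum_nat_const muln1 sum_nsqrt => -[_]; rewrite cardT -cardE eqxx.
move/esym/forallP/(_ 1)/eqP => /esym/eqP/cards1P[u /setP eu].
have := eu 1; have := eu (- 1); rewrite !inE sqrrN expr1n eqxx => /esym/eqP <-.
move/esym/eqP => e; case/eqP: nz2; rewrite mulr2n.
by rewrite {1}e addNr.
Qed.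

End SquareRoots.

Definition addchar (F : finFieldType) (psi : F -> algC) : Prop :=
  [/\ psi 0 = 1, forall x y, psi (x + y) = psi x * psi y
    & exists x, psi x != 1].

Lemma addchar_exists (F : finFieldType) : exists psi : F -> algC, addchar psi.
Proof.
pose G := [set: F]%G.
have abG : abelian G by apply: FinRing.Theory.zmod_abelian.
have [i nzi] : exists i : Iirr G, i != 0.
  apply/existsP; apply: contraTT (card_finNzRing_gt1 F) => /existsPn h.
  rewrite -cardsT -(card_Iirr_abelian abG) -leqNgt -(card1 (0 : Iirr G)).
  by apply/subset_leq_card/subsetP => i _; rewrite inE; have := h i; rewrite negbK.
have lin : 'chi_i \is a linear_char by move/char_abelianP: abG.
exists 'chi_i; split; first exact: lin_char1 lin.
  by move=> x y; apply: (lin_charM lin); rewrite inE.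
apply/existsP; apply: contraTT nzi => /existsPn h; rewrite negbK -irr_eq1.
by apply/eqP/cfunP => x; rewrite cfun1E inE; have := h x; rewrite negbK => /eqP.
Qed.

Section AddChar.
Variables (F : finFieldType) (psi : F -> algC).
Hypothesis psiP : addchar psi.

Lemma addchar0 : psi 0 = 1. Proof. by case: psiP. Qed.

Lemma addcharD x y : psi (x + y) = psi x * psi y. Proof. by case: psiP. Qed.

Lemma addchar_neq0 x : psi x != 0.
Proof.
apply/eqP => p0; have := addchar0; rewrite -(subrr x) addcharD p0 mul0r.
by move/esym/eqP; rewrite oner_eq0.
Qed.

Lemma addcharMn x n : psi (x *+ n) = psi x ^+ n.
Proof. by elim: n => [|n IH]; rewrite ?addchar0 // mulrS addcharD IH exprS. Qed.

Lemma norm_addchar x : `|psi x| = 1.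
Proof.
(* The characteristic kills [x], so [psi x] is a root of unity. *)
have [p p_pr pF] := finPcharP F.
have : `|psi x| ^+ p == 1.
  by rewrite -normrX -addcharMn mulrn_pchar // addchar0 normr1.
by rewrite pexprn_eq1 ?normr_ge0 // (gtn_eqF (prime_gt0 p_pr)) => /eqP.
Qed.

Lemma conj_addchar x : (psi x)^* = psi (- x).
Proof.
apply: (mulfI (addchar_neq0 x)).
by rewrite -normCK norm_addchar expr1n -addcharD subrr addchar0.
Qed.

Lemma addchar_sum (I : Type) (s : seq I) (P : pred I) (f : I -> F) :
  psi (\sum_(i <- s | P i) f i) = \prod_(i <- s | P i) psi (f i).
Proof. exact: (big_morph psi addcharD addchar0). Qed.

Lemma sum_addchar : \sum_x psi x = 0.
Proof.
case: psiP => _ _ [a na]; apply/eqP.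
have : (psi a - 1) * \sum_x psi x == 0.
  rewrite mulrBl mul1r subr_eq0 mulr_sumr [eqbRHS](reindex_inj (addrI a)) /=.
  by apply/eqP/eq_bigr => x _; rewrite addcharD.
by rewrite mulf_eq0 subr_eq0 (negPf na).
Qed.

Lemma sum_addcharM a : \sum_x psi (a * x) = #|F|%:R *+ (a == 0).
Proof.
have [->|nza] := eqVneq a 0.
  under eq_bigr do rewrite mul0r addchar0.
  by rewrite sumr_const.
by rewrite -[RHS]sum_addchar [RHS](reindex_inj (mulfI nza)).
Qed.

Lemma sum_addcharM_neq0 a : \sum_(x | x != 0) psi (a * x) = #|F|%:R *+ (a == 0) - 1.
Proof.
by rewrite -sum_addcharM [in RHS](bigD1 0) //= mulr0 addchar0 [1 + _]addrC addrK.
Qed.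

End AddChar.

(** * Quadratic extensions of rings *)

(* [quad w c] is R[X] / (X^2 - w X + c), the pair (a, b) standing for a + b X. *)
Definition quad (R : comNzRingType) (w c : R) : Type := (R * R)%type.

Section QuadRing.
Variables (R : comNzRingType) (w c : R).
Local Notation A := (quad w c).

HB.instance Definition _ := GRing.Zmodule.copy A (R * R)%type.

Definition quad_one : A := (1, 0).
Definition quad_mul (u v : A) : A :=
  (u.1 * v.1 - c * u.2 * v.2, u.1 * v.2 + u.2 * v.1 + w * u.2 * v.2).

Fact quad_mulA : associative quad_mul.
Proof. by case=> [? ?] [? ?] [? ?]; congr (_, _); rewrite /=; ring. Qed.
Fact quad_mulC : commutative quad_mul.
Proof. by case=> [? ?] [? ?]; congr (_, _); rewrite /=; ring. Qed.
Fact quad_mul1 : left_id quad_one quad_mul.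
Proof. by case=> [? ?]; congr (_, _); rewrite /=; ring. Qed.
Fact quad_mulDl : left_distributive quad_mul +%R.
Proof. by case=> [? ?] [? ?] [? ?]; congr (_, _); rewrite /=; ring. Qed.
Fact quad_one_neq0 : quad_one != 0.
Proof. by apply/eqP => -[] /eqP; rewrite oner_eq0. Qed.

HB.instance Definition _ :=
  GRing.Zmodule_isComNzRing.Build A quad_mulA quad_mulC quad_mul1 quad_mulDl quad_one_neq0.

Lemma quadME (u v : A) :
  u * v = (u.1 * v.1 - c * u.2 * v.2, u.1 * v.2 + u.2 * v.1 + w * u.2 * v.2) :> R * R.
Proof. by []. Qed.

Definition qconst (a : R) : A := (a, 0).
Definition qX : A := (0, 1).

Fact qconst_is_zmod_morphism : zmod_morphism qconst.
Proof. by move=> a b; congr (_, _); rewrite /=; ring. Qed.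
Fact qconst_is_monoid_morphism : monoid_morphism qconst.
Proof. by split=> // a b; rewrite /qconst [RHS]quadME /=; congr (_, _); ring. Qed.
HB.instance Definition _ := GRing.isZmodMorphism.Build R A qconst qconst_is_zmod_morphism.
HB.instance Definition _ := GRing.isMonoidMorphism.Build R A qconst qconst_is_monoid_morphism.

Lemma quadE (u : A) : u = qconst u.1 + qconst u.2 * qX.
Proof. by case: u => a b; rewrite quadME /=; congr (_, _); rewrite /=; ring. Qed.

Definition qnorm (u : A) : R := u.1 ^+ 2 + u.1 * u.2 * w + c * u.2 ^+ 2.

Lemma qnormM : {morph qnorm : u v / u * v}.
Proof. by move=> u v; rewrite /qnorm quadME /=; ring. Qed.

Definition qtrace (u : A) : R := u.1 *+ 2 + u.2 * w.

Definition qconj (u : A) : A := (u.1 + u.2 * w, - u.2).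

Fact qconj_is_zmod_morphism : zmod_morphism qconj.
Proof. by move=> u v; congr (_, _); rewrite /=; ring. Qed.
Fact qconj_is_monoid_morphism : monoid_morphism qconj.
Proof.
split=> [|u v]; first by congr (_, _); rewrite /=; ring.
by rewrite [RHS]quadME /=; congr (_, _); rewrite /=; ring.
Qed.
HB.instance Definition _ := GRing.isZmodMorphism.Build A A qconj qconj_is_zmod_morphism.
HB.instance Definition _ := GRing.isMonoidMorphism.Build A A qconj qconj_is_monoid_morphism.

Lemma qconjM : {morph qconj : u v / u * v}.
Proof. exact: qconj_is_monoid_morphism.2. Qed.

Lemma qconjN : {morph qconj : u / - u}.
Proof. by move=> u; congr (_, _); rewrite /=; ring. Qed.

Lemma qconjX u n : qconj (u ^+ n) = qconj u ^+ n.
Proof.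
elim: n => [|n IH]; last by rewrite !exprS qconjM IH.
exact: qconj_is_monoid_morphism.1.
Qed.

Lemma qtraceE u : qconst (qtrace u) = u + qconj u.
Proof. by congr (_, _); rewrite /qtrace /=; ring. Qed.

Lemma qnormE u : qconst (qnorm u) = u * qconj u.
Proof. by rewrite [RHS]quadME /qconst /qnorm /=; congr (_, _); ring. Qed.

End QuadRing.

Section QuadField.
Variables (F : finFieldType) (m : {m : F | nsqrt m == 0%N}).

(** Here X^2 = m with m a nonsquare, so this is the quadratic extension of [F]. *)
Definition quadf : Type := quad 0 (- val m).
HB.instance Definition _ := GRing.ComNzRing.on quadf.
HB.instance Definition _ := Finite.copy quadf (F * F)%type.

Lemma card_quadf : #|{: quadf}| = (#|F| ^ 2)%N.
Proof. by rewrite card_prod. Qed.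

Local Notation K := (quad 0 (- val m)).

Lemma quadf_norm_eq0 (u : K) : (qnorm u == 0) = (u == 0).
Proof.
apply/eqP/eqP => [|->]; last by rewrite /qnorm /=; ring.
case: u => a b; rewrite /qnorm /= mulr0 addr0 mulNr => /eqP; rewrite subr_eq0 => /eqP e.
have [b0|nzb] := eqVneq b 0.
  by move/eqP: e; rewrite b0 expr0n mulr0 sqrf_eq0 => /eqP ->.
have : (0 < nsqrt (val m))%N.
  by apply/nsqrt_gt0P; exists (a / b); rewrite expr_div_n e mulfK // expf_neq0.
by rewrite (eqP (valP m)).
Qed.

Definition quadf_inv (u : K) : K := qconst 0 (- val m) (qnorm u)^-1 * qconj u.

Fact quadf_mulVf (u : K) : u != 0 -> quadf_inv u * u = 1.
Proof.
move=> nzu; rewrite /quadf_inv -mulrA [_ * u]mulrC -qnormE -rmorphM.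
by rewrite mulVf ?quadf_norm_eq0 // rmorph1.
Qed.

Fact quadf_inv0 : quadf_inv 0 = 0.
Proof. by rewrite /quadf_inv rmorph0 mulr0. Qed.

HB.instance Definition _ := GRing.ComNzRing_isField.Build quadf quadf_mulVf quadf_inv0.

Definition quadf_const (a : F) : quadf := (a, 0).
Definition quadf_trace (z : quadf) : F := z.1 *+ 2.

Lemma quadf_normE (z : K) : qnorm z = z.1 ^+ 2 - val m * z.2 ^+ 2.
Proof. by rewrite /qnorm mulr0 addr0 mulNr. Qed.

Lemma quadf_neq0 (z : quadf) : (z != 0) = (z.1 ^+ 2 - val m * z.2 ^+ 2 != 0).
Proof. by rewrite -[z == 0]quadf_norm_eq0 quadf_normE. Qed.

Lemma quadf_divE a (z : quadf) : z != 0 ->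
  quadf_const a / z =
  (a / (z.1 ^+ 2 - val m * z.2 ^+ 2) * z.1, - (a / (z.1 ^+ 2 - val m * z.2 ^+ 2) * z.2)).
Proof.
move=> nzz; apply: (mulIf nzz); rewrite mulfVK //.
move: nzz; rewrite quadf_neq0.
case: z => x y; set k := val m => /= nz.
apply: etrans (esym (quadME (_ : K) (_ : K))); rewrite -/k /quadf_const.
by congr (_, _); rewrite /=; field.
Qed.

Lemma quadf_traceD : {morph quadf_trace : x y / x + y}.
Proof. by move=> x y; rewrite /quadf_trace /= mulrnDl. Qed.
End QuadField.

(** * Kloosterman sums over a field and its quadratic extension *)

Lemma sum_sqr (F : finFieldType) (g : F -> algC) :
  \sum_v g (v ^+ 2) = \sum_x (nsqrt x)%:R * g x.
Proof.
rewrite (partition_big (fun v : F => v ^+ 2) predT) //=; apply: eq_bigr => x _.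
rewrite (eq_bigr (fun=> g x)) => [|v /eqP -> //].
by rewrite sumr_const mulr_natl; congr (_ *+ _); apply: eq_card => v; rewrite inE.
Qed.

Definition kloosterman (F : finFieldType) (psi : F -> algC) (c : F) : algC :=
  \sum_(x | x != 0) psi (x + c / x).

Lemma kloosterman_real (F : finFieldType) (psi : F -> algC) c :
  addchar psi -> (kloosterman psi c)^* = kloosterman psi c.
Proof.
move=> psiP; rewrite /kloosterman rmorph_sum (reindex_inj oppr_inj) /=.
apply: eq_big => x; first by rewrite oppr_eq0.
by rewrite conj_addchar // invrN mulrN -opprD opprK.
Qed.

Section KloostermanQuadratic.
Variables (F : finFieldType) (psi : F -> algC) (c : F) (m : {m : F | nsqrt m == 0%N}).
Hypotheses (psiP : addchar psi) (nz2 : (2%:R : F) != 0) (nzc : c != 0).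

Definition addchar_quad (z : quadf m) : algC := psi (quadf_trace z).

Lemma addchar_quadP : addchar addchar_quad.
Proof.
split=> [|x y|]; first by rewrite /addchar_quad /quadf_trace mul0rn addchar0.
  by rewrite /addchar_quad quadf_traceD addcharD.
have [_ _ [x nx]] := psiP; exists (x / 2%:R, 0).
by rewrite /addchar_quad /quadf_trace /= -(mulr_natr (x / 2%:R) 2) mulfVK.
Qed.

(** In the square of the sum put x = a + v, y = a - v: the summand becomes psi (2 a (1 + c / (a^2 -
    v^2))), which depends only on a and v^2. Over the extension, z = a + v sqrt m has trace 2 a and
    norm a^2 - m v^2, so the same function [g] appears with m v^2 in place of v^2. Each x is hit by
    v^2 and m v^2 twice in all, and what remains is twice the sum of [g a x] over all a and x. With
    n = a^2 - x, the sum over a vanishes unless 1 + c / n = 0. *)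
Lemma kloosterman_quad :
  kloosterman psi c ^+ 2 + kloosterman addchar_quad (quadf_const m c) = 2 * #|F|%:R.
Proof.
pose g (a x : F) := psi (a *+ 2 * (1 + c / (a ^+ 2 - x))) *+ (a ^+ 2 - x != 0).
have -> : kloosterman psi c ^+ 2 = \sum_a \sum_v g a (v ^+ 2).
  rewrite expr2 /kloosterman big_mkcond /= big_distrlr /=.
  rewrite pair_bigA [RHS]pair_bigA /=.
  pose h (p : F * F) := (p.1 + p.2, p.1 - p.2).
  have hI : injective h.
    move=> [a b] [a' b'] [e1 e2].
    have ea : a *+ 2 = a' *+ 2 by transitivity ((a + b) + (a - b)); [ring | rewrite e1 e2; ring].
    have {ea} ea : a = a' by move: ea; rewrite -(mulr_natr a) -(mulr_natr a') => /(mulIf nz2).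
    by move: e1; rewrite ea => /addrI ->.
  rewrite (reindex_inj hI); apply: eq_bigr => -[a v] _ /=.
  rewrite /g /= subr_sqr mulf_eq0 negb_or.
  have [e0|nzx] := eqVneq (a + v) 0; first by rewrite /= mul0r andbF.
  have [e0|nzy] := eqVneq (a - v) 0; first by rewrite /= mulr0.
  rewrite /= mulr1n -addcharD //; congr psi.
  have -> : a *+ 2 = (a + v) + (a - v) by ring.
  by field; rewrite nzx nzy.
have -> : kloosterman addchar_quad (quadf_const m c) =
    \sum_a \sum_v g a (val m * v ^+ 2).
  rewrite /kloosterman big_mkcond /= pair_bigA /=.
  apply: eq_bigr => -[a v] _ /=.
  rewrite quadf_neq0 /g /=; have [//|nz] := eqVneq (a ^+ 2 - val m * v ^+ 2) 0.
  have nzz : (a, v) != 0 :> quadf m by rewrite quadf_neq0.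
  rewrite (quadf_divE _ nzz) /addchar_quad quadf_traceD /quadf_trace /= mulr1n.
  by congr psi; ring.
have nzm : val m != 0.
  by apply: contra_eq_neq (eqP (valP m)) => ->; rewrite nsqrt0.
have sumE a : \sum_v g a (v ^+ 2) + \sum_v g a (val m * v ^+ 2) = 2 * \sum_x g a x.
  rewrite (sum_sqr (g a)) (sum_sqr (fun y => g a (val m * y))).
  have -> : \sum_x (nsqrt x)%:R * g a (val m * x) = \sum_x (nsqrt (val m * x))%:R * g a x.
    rewrite [RHS](reindex_inj (mulfI nzm)); apply: eq_bigr => x _; congr (_%:R * _).
    by rewrite mulrA -expr2 mulrC nsqrtM2.
  rewrite -big_split mulr_sumr; apply: eq_bigr => x _ /=.
  by rewrite -mulrDl -natrD nsqrt_nonsquare // (eqP (valP m)).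
rewrite -big_split /=; under eq_bigr do rewrite sumE.
rewrite -mulr_sumr; congr (_ * _).
have subI a : injective (fun x : F => a ^+ 2 - x) by move=> x y /addrI/oppr_inj.
rewrite (eq_bigr (fun a => \sum_n g a (a ^+ 2 - n))) => [|a _]; last first.
  exact: reindex_inj (subI a).
rewrite exchange_big /=.
have sum_n n : \sum_a g a (a ^+ 2 - n) = #|F|%:R *+ (n == - c).
  have [->|nzn0] := eqVneq n 0.
    rewrite big1 => [|a _]; first by rewrite eq_sym oppr_eq0 (negPf nzc).
    by rewrite /g subKr eqxx mulr0n.
  rewrite (eq_bigr (fun a => psi ((2%:R * (1 + c / n)) * a))) => [|a _]; last first.
    by rewrite /g subKr nzn0 mulr1n; congr psi; ring.
  rewrite sum_addcharM // mulf_eq0 (negPf nz2) /=; congr (_ *+ nat_of_bool _).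
  by rewrite -(inj_eq (mulIf nzn0)) mul0r mulrDl mul1r divfK // addr_eq0.
under eq_bigr do rewrite sum_n.
by rewrite (bigD1 (- c)) //= eqxx big1 ?addr0 // => n /negPf ->.
Qed.
End KloostermanQuadratic.

(** * The Stepanov-Bombieri method *)

(** The summands occupy disjoint ranges of degrees, like digits in base X^s. *)
Lemma digits_eq0 (R : nzRingType) (s n : nat) (f : 'I_n -> {poly R}) :
  (forall i, size (f i) <= s)%N -> \sum_i f i * 'X^(s * i) = 0 -> forall i, f i = 0.
Proof.
move=> sz sum0 i; apply/polyP => j; rewrite coef0.
have [sj|js] := leqP s j; first by apply: nth_default; apply: leq_trans sj.
have := congr1 (fun p : {poly R} => p`_(s * i + j)) sum0.
rewrite coef0 coef_sum (bigD1 i) //= coefMXn ltnNge leq_addr /= addKn big1 ?addr0 //.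
move=> i' ni; rewrite coefMXn; case: ltnP => // le; apply: nth_default.
apply: leq_trans (sz i') _; move: ni; rewrite -val_eqE /= => ni; nia.
Qed.

Lemma Frobenius_horner (R : comNzRingType) (s : nat) (p : {poly R}) (x : R) :
  [pchar R].-nat s -> p.[x] ^+ s = \sum_(i < size p) p`_i ^+ s * (x ^+ i) ^+ s.
Proof.
move=> hs; rewrite horner_coef.
have s0 : (0 ^+ s = 0 :> R) by case/andP: hs => s_gt0 _; rewrite expr0n eqn0Ngt s_gt0.
rewrite (big_morph (fun y : R => y ^+ s) (id1 := 0) (op1 := +%R)) //.
  by apply: eq_bigr => i _; rewrite exprMn.
by move=> a b; rewrite exprDn_pchar.
Qed.

Section PolesAtInfinity.
Variables (K : finFieldType) (w : {poly K}) (c : K).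
Local Notation A := (quad w c%:P).
Local Notation D := (size w).-1.
Local Notation cst := (qconst w c%:P).
Local Notation X := (qX w c%:P).
Local Notation Y := (cst 'X).

Hypothesis w_nc : (1 < size w)%N.

(* [qdeg_le m] is the space of functions with poles of order at most [m] at the two
   points at infinity of the curve. *)
Definition qdeg_le (m : nat) (u : A) := (size u.1 <= m.+1)%N && (size u.2 <= m.+1 - D)%N.

Lemma qdeg_leW m n u : (m <= n)%N -> qdeg_le m u -> qdeg_le n u.
Proof. rewrite /qdeg_le; lia. Qed.

Lemma qdeg_le_cst m a : qdeg_le m (cst a) = (size a <= m.+1)%N.
Proof. by rewrite /qdeg_le /= size_poly0 andbT. Qed.

Lemma qdeg_leX : qdeg_le D X.
Proof. by rewrite /qdeg_le /= size_poly0 size_poly1; move: w_nc; lia. Qed.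

Lemma qdeg_leD m u v : qdeg_le m u -> qdeg_le m v -> qdeg_le m (u + v).
Proof.
move=> /andP[u1 u2] /andP[v1 v2]; apply/andP; split.
  by apply: leq_trans (size_polyD _ _) _; rewrite geq_max u1.
by apply: leq_trans (size_polyD _ _) _; rewrite geq_max u2.
Qed.

Lemma qdeg_leN m u : qdeg_le m (- u) = qdeg_le m u.
Proof. by rewrite /qdeg_le /= !size_polyN. Qed.

Lemma qdeg_le_sum m (I : Type) (s : seq I) (P : pred I) (f : I -> A) :
  (forall i, P i -> qdeg_le m (f i)) -> qdeg_le m (\sum_(i <- s | P i) f i).
Proof.
move=> h; apply: (big_ind (qdeg_le m)) => //.
  by rewrite -(rmorph0 cst) qdeg_le_cst size_poly0.
by move=> u v; apply: qdeg_leD.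
Qed.

(** Each coefficient of X is [D] short of the full degree. Reducing by X^2 = w X - c multiplies the
    product of two of them by [w], which uses up only one of the two savings. *)
Lemma qdeg_leM m n u v : qdeg_le m u -> qdeg_le n v -> qdeg_le (m + n) (u * v).
Proof.
have szM (p q : {poly K}) a b k : (size p <= a)%N -> (size q <= b)%N ->
    (a + b <= k.+1)%N -> (size (p * q)%R <= k)%N.
  by move=> pa qb ab; apply: leq_trans (size_polyMleq _ _) _; lia.
have szM0 (p q : {poly K}) a b k : (size p <= a)%N -> (size q <= b)%N ->
    (a = 0 \/ b = 0 \/ a + b <= k.+1)%N -> (size (p * q)%R <= k)%N.
  move=> pa qb [a0|[b0|]]; last exact: szM.
    by move: pa; rewrite a0 leqn0 size_poly_eq0 => /eqP ->; rewrite mul0r size_poly0.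
  by move: qb; rewrite b0 leqn0 size_poly_eq0 => /eqP ->; rewrite mulr0 size_poly0.
move=> /andP[u1 u2] /andP[v1 v2]; rewrite /qdeg_le quadME /=; apply/andP; split.
  apply: leq_trans (size_polyD _ _) _; rewrite geq_max size_polyN (szM _ _ _ _ _ u1 v1) ?addnS //=.
  rewrite -mulrA mul_polyC (leq_trans (size_scale_leq _ _)) //.
  by apply: szM0 u2 v2 _; lia.
apply: leq_trans (size_polyD _ _) _; rewrite geq_max; apply/andP; split.
  apply: leq_trans (size_polyD _ _) _; rewrite geq_max.
  by apply/andP; split; [apply: szM0 u1 v2 _ | apply: szM0 u2 v1 _]; move: (_.-1) => d; lia.
have [->|nzu] := eqVneq u.2 0; first by rewrite mulr0 mul0r size_poly0.
have [->|nzv] := eqVneq v.2 0; first by rewrite mulr0 size_poly0.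
move: nzu nzv; rewrite -!size_poly_gt0 => s1 s2.
apply: leq_trans (size_polyMleq _ _) _.
move: (size_polyMleq w u.2) w_nc s1 s2 u2 v2.
by move: (size _) (size _) (size _) (size _) => a b d e; lia.
Qed.

Lemma qdeg_leXn m n u : qdeg_le m u -> qdeg_le (m * n) (u ^+ n).
Proof.
move=> h; elim: n => [|n IH]; last by rewrite exprS mulnS qdeg_leM.
by rewrite muln0 expr0 -(rmorph1 cst) qdeg_le_cst size_poly1.
Qed.

Lemma qdeg_leY n : qdeg_le n (Y ^+ n).
Proof. by rewrite -rmorphXn qdeg_le_cst size_polyXn. Qed.

(** Conjugation exchanges the two points at infinity. *)
Lemma qdeg_le_conj m u : qdeg_le m u -> qdeg_le m (qconj u).
Proof.
move=> /andP[u1 u2]; rewrite /qdeg_le /= size_polyN u2 andbT.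
apply: leq_trans (size_polyD _ _) _; rewrite geq_max u1 /=.
have [->|nzu] := eqVneq u.2 0; first by rewrite mul0r size_poly0.
move: nzu; rewrite -!size_poly_gt0 => s1.
move: (size_polyMleq u.2 w) w_nc s1 u2.
by move: (size _) (size _) (size _) => a b d; lia.
Qed.

Definition coef_qdeg_le m (p : {poly A}) := forall i, qdeg_le m p`_i.

Lemma coef_qdeg_leM m n p q :
  coef_qdeg_le m p -> coef_qdeg_le n q -> coef_qdeg_le (m + n) (p * q).
Proof.
by move=> hp hq i; rewrite coefM; apply: qdeg_le_sum => j _; apply: qdeg_leM.
Qed.

Lemma coef_qdeg_leD m p q :
  coef_qdeg_le m p -> coef_qdeg_le m q -> coef_qdeg_le m (p + q).
Proof. by move=> hp hq i; rewrite coefD; apply: qdeg_leD. Qed.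

Lemma coef_qdeg_le_conj m p :
  coef_qdeg_le m p -> coef_qdeg_le m (map_poly (@qconj _ w c%:P) p).
Proof. by move=> hp i; rewrite coef_map; apply: qdeg_le_conj. Qed.

Lemma quad_digits_eq0 m s (p : {poly A}) :
  (m < s)%N -> coef_qdeg_le m p -> p.[Y ^+ s] = 0 -> p = 0.
Proof.
move=> ms hp; rewrite horner_coef => p0; apply/polyP => i; rewrite coef0.
have [si|i_lt] := leqP (size p) i; first exact: nth_default.
have eY (j : nat) : (Y ^+ s) ^+ j = cst 'X^(s * j) by rewrite -exprM -rmorphXn.
pose f1 (j : 'I_(size p)) := (p`_j).1; pose f2 (j : 'I_(size p)) := (p`_j).2.
have e : \sum_j f1 j * 'X^(s * j) = 0 /\ \sum_j f2 j * 'X^(s * j) = 0.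
  have : \sum_j cst (f1 j * 'X^(s * j)) + (\sum_j cst (f2 j * 'X^(s * j))) * X = 0.
    rewrite mulr_suml -big_split -[RHS]p0; apply: eq_bigr => j _ /=.
    by rewrite eY [in RHS](quadE p`_j) !rmorphM /=; ring.
  rewrite -!rmorph_sum => e.
  have := congr1 fst e; have := congr1 snd e; rewrite /= => e2 e1; split.
    by rewrite -[RHS]e1; ring.
  by rewrite -[RHS]e2; ring.
have [/digits_eq0 z1 /digits_eq0 z2] := e.
have szp j : ((size (f1 j) <= s) /\ (size (f2 j) <= s))%N.
  by have /andP[] := hp j; rewrite /f1 /f2; lia.
have := z1 (fun j => (szp j).1) (Ordinal i_lt); have := z2 (fun j => (szp j).2) (Ordinal i_lt).
by rewrite /f1 /f2 /=; case: (p`_i) => a b /= -> ->.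
Qed.

Hypotheses (nz2 : (2%:R : K) != 0) (nzc : c != 0).

(** This is the irreducibility of the curve. A nontrivial zero of the norm would make the
    discriminant w^2 - 4 c a square h^2; then (w - h)(w + h) = 4 c is a nonzero constant, so both
    factors are constant, and so is their sum 2 w. *)
Lemma quad_poly_norm_eq0 (u : A) : (qnorm u == 0) = (u == 0).
Proof.
apply/eqP/eqP => [|->]; last by rewrite /qnorm /=; ring.
case: u => a b; rewrite /qnorm /= => n0.
have [b0|nzb] := eqVneq b 0.
  by move/eqP: n0; rewrite b0 mulr0 mul0r expr0n mulr0 !addr0 sqrf_eq0 => /eqP ->.
have e : (a *+ 2 + b * w) ^+ 2 = b ^+ 2 * (w ^+ 2 - c%:P *+ 4).
  transitivity ((a ^+ 2 + a * b * w + c%:P * b ^+ 2) *+ 4 + b ^+ 2 * (w ^+ 2 - c%:P *+ 4)).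
    by ring.
  by rewrite n0 mul0rn add0r.
have : b %| a *+ 2 + b * w.
  by rewrite -(@dvdp_pexp2r _ _ _ 2) // e dvdp_mulr.
case/dvdpP=> h hE.
have e2 : (w - h) * (w + h) = (c *+ 4)%:P.
  rewrite -subr_sqr polyCMn; apply: (mulfI (expf_neq0 2 nzb)).
  have -> : b ^+ 2 * (w ^+ 2 - h ^+ 2) = b ^+ 2 * w ^+ 2 - (h * b) ^+ 2 by ring.
  by rewrite -hE e; ring.
have nz4 : c *+ 4 != 0.
  by rewrite -mulr_natr (natrM _ 2 2) !mulf_neq0.
have [nz1 nz3] : w - h != 0 /\ w + h != 0.
  by apply/andP; rewrite -negb_or -mulf_eq0 e2 polyC_eq0.
have := size_mul nz1 nz3; rewrite e2 size_polyC nz4.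
move: nz1 nz3; rewrite -!size_poly_gt0 /= => s1 s3 ss.
have : (size (w *+ 2) <= 1)%N.
  have -> : w *+ 2 = (w - h) + (w + h) by ring.
  apply: leq_trans (size_polyD _ _) _; rewrite geq_max; by move: (size _) (size _) s1 s3 ss => m n; lia.
by rewrite -scaler_nat size_scale // leqNgt w_nc.
Qed.

Lemma quad_poly_mulf_neq0 (u v : A) : u != 0 -> v != 0 -> u * v != 0.
Proof. by rewrite -!quad_poly_norm_eq0 qnormM => *; apply: mulf_neq0. Qed.

Lemma size_quad_polyM (p q : {poly A}) : p != 0 -> q != 0 ->
  size (p * q) = (size p + size q).-1.
Proof.
by move=> nzp nzq; apply: size_proper_mul; rewrite quad_poly_mulf_neq0 ?lead_coef_eq0.
Qed.

End PolesAtInfinity.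

Section StepanovAuxiliary.
Variables (K : finFieldType) (w : {poly K}) (c : K) (s : nat).
Local Notation A := (quad w c%:P).
Local Notation D := (size w).-1.
Local Notation cst := (qconst w c%:P).
Local Notation X := (qX w c%:P).
Local Notation Y := (cst 'X).

Hypotheses (nz2 : (2%:R : K) != 0) (nzc : c != 0) (w_nc : (1 < size w)%N).
Hypothesis hs : [pchar K].-nat s.

Lemma quad_pchar_nat : [pchar A].-nat s.
Proof.
apply: sub_in_pnat hs => p _ pK; apply: (rmorph_pchar cst).
by apply: (rmorph_pchar (@polyC K)).
Qed.

Lemma qX_exp : X ^+ s + qconj X ^+ s = cst (w ^+ s).
Proof.
rewrite -exprDn_pchar ?quad_pchar_nat // -qtraceE rmorphXn; congr (cst _ ^+ s).
by rewrite /qtrace /= mul0rn add0r mul1r.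
Qed.

Lemma qX_norm : X * qconj X = cst c%:P.
Proof. by rewrite -qnormE; congr cst; rewrite /qnorm /=; ring. Qed.

(** By Frobenius, w^s is a polynomial in Z = Y^s with constant coefficients; this is that
    polynomial. *)
Let W : {poly A} := map_poly (fun a => cst (a ^+ s)%:P) w.

Let s_gt0 : (0 < s)%N. Proof. by case/andP: hs. Qed.

Let Wcoef i : W`_i = cst (w`_i ^+ s)%:P.
Proof. by rewrite coef_map_id0 // expr0n eqn0Ngt s_gt0 rmorph0. Qed.

Let W_size : size W = size w.
Proof.
apply: size_map_poly_id0; apply/eqP => /(congr1 fst) /eqP /=.
by rewrite polyC_eq0 expf_eq0 s_gt0 lead_coef_eq0 => /eqP w0; move: w_nc; rewrite w0 size_poly0.
Qed.

Let W_horner : W.[Y ^+ s] = cst (w ^+ s).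
Proof.
have wE : cst w = (map_poly (cst \o polyC) w).[Y].
  by rewrite map_poly_comp horner_map /= -[map_poly polyC w]/(w ^:P) -[_.['X]]/(w \Po 'X) comp_polyXr.
rewrite [RHS]rmorphXn /= wE (Frobenius_horner _ _ quad_pchar_nat) horner_coef W_size.
have -> : size (map_poly (cst \o polyC) w) = size w.
  by apply: size_map_inj_poly => [a b /(congr1 fst)/polyC_inj|]; rewrite ?rmorph0.
by apply: eq_bigr => i _; rewrite Wcoef coef_map /= polyC_exp rmorphXn /= [(Y ^+ s) ^+ _]exprAC.
Qed.

(* Read as an identity in a new variable Z = Y ^ s, the relation says that p = - q X ^ s;
   taking norms gives deg p = deg q in Z, while the trace of p (conj q) equals
   - N(q) w ^ s, whose degree in Z exceeds deg p + deg q. *)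
Lemma no_frobenius_relation m (p q : {poly A}) : (m.*2 < s)%N ->
  coef_qdeg_le m p -> coef_qdeg_le m q ->
  p.[Y ^+ s] + q.[Y ^+ s] * X ^+ s = 0 -> p = 0 /\ q = 0.
Proof.
move=> ms hp hq /eqP; rewrite addr_eq0 => /eqP pq.
pose cj := map_poly (@qconj _ w c%:P).
have conjE u : (cj u).[Y ^+ s] = qconj u.[Y ^+ s].
  rewrite -horner_map /= rmorphXn; congr (_.[_ ^+ s]).
  by rewrite -[RHS]/('X + 0 * w, - 0) mul0r addr0 oppr0.
have pq' : qconj p.[Y ^+ s] = - (qconj q.[Y ^+ s] * qconj X ^+ s).
  by rewrite -qconjX -qconjM -qconjN pq.
have hcp := coef_qdeg_le_conj w_nc hp; have hcq := coef_qdeg_le_conj w_nc hq.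
have cst_le k a : qdeg_le k (cst a%:P) by rewrite qdeg_le_cst size_polyC; case: eqP.
(* The products below have coefficients with poles of order at most [m.*2 < s], so an identity at
   [Y ^+ s] is an identity of polynomials in Z. *)
have e1 : p * cj p - (cst (c ^+ s)%:P)%:P * (q * cj q) = 0.
  apply: (quad_digits_eq0 w_nc ms) => [i|].
    rewrite coefD coefN coefCM; apply: qdeg_leD; rewrite ?qdeg_leN.
      by rewrite -addnn; apply: (coef_qdeg_leM w_nc).
    by rewrite -[m.*2]add0n; apply: (qdeg_leM w_nc) => //; rewrite -addnn; apply: (coef_qdeg_leM w_nc).
  rewrite hornerD hornerN !hornerM hornerC !conjE pq' pq.
  have -> : cst (c ^+ s)%:P = X ^+ s * qconj X ^+ s by rewrite -exprMn qX_norm !rmorphXn.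
  by ring.
have e2 : p * cj q + cj p * q + q * cj q * W = 0.
  apply: (quad_digits_eq0 w_nc ms).
    apply: coef_qdeg_leD; first by apply: coef_qdeg_leD; rewrite -addnn; apply: (coef_qdeg_leM w_nc).
    rewrite -[m.*2]addn0; apply: (coef_qdeg_leM w_nc); first by rewrite -addnn; apply: (coef_qdeg_leM w_nc).
    by move=> i; rewrite Wcoef.
  rewrite !hornerD !hornerM !conjE pq' pq W_horner -qX_exp.
  by ring.
have sz_cj u : size (cj u) = size u.
  apply: size_map_inj_poly; last exact: rmorph0.
  by apply: (can_inj (g := @qconj _ w c%:P)) => -[a b]; rewrite /qconj /=; congr (_, _); ring.
have cj0 u : (cj u == 0) = (u == 0) by rewrite -!size_poly_eq0 sz_cj.
have szM := size_quad_polyM w_nc nz2 nzc.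
have [q0|nzq] := eqVneq q 0.
  split=> //; apply/eqP; apply: contraT => nzp.
  have := szM p (cj p) nzp; rewrite cj0 => /(_ nzp).
  move/eqP: e1; rewrite q0 mul0r mulr0 subr0 => /eqP ->.
  by rewrite size_poly0 sz_cj; move: nzp; rewrite -size_poly_gt0; move: (size _) => a; lia.
have nzcq : q * cj q != 0.
  rewrite -size_poly_eq0 szM ?cj0 // sz_cj.
  by move: nzq; rewrite -size_poly_gt0; move: (size _) => a; lia.
have nzC : (cst (c ^+ s)%:P)%:P != 0 :> {poly A}.
  rewrite polyC_eq0; apply/eqP => /(congr1 fst) /eqP /=.
  by rewrite polyC_eq0 expf_eq0 (negPf nzc) andbF.
have nzW : W != 0 by rewrite -size_poly_eq0 W_size; case: size w_nc.
have szpp : size (p * cj p) = size (q * cj q).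
  move/eqP: e1; rewrite subr_eq0 => /eqP ->.
  by rewrite (szM _ _ nzC nzcq) size_polyC -polyC_eq0 nzC.
have nzp : p != 0.
  apply: contra_eq_neq szpp => ->; rewrite mul0r size_poly0 eq_sym size_poly_eq0 //.
have spq : size p = size q.
  move: szpp; rewrite !szM ?cj0 // !sz_cj; move: nzp nzq; rewrite -!size_poly_gt0.
  by move: (size p) (size q) => a b; lia.
have : (size (q * cj q * W)%R <= (size p + size q).-1)%N.
  have -> : q * cj q * W = - (p * cj q + cj p * q).
    by apply/eqP; rewrite -addr_eq0 addrC e2.
  rewrite size_polyN (leq_trans (size_polyD _ _)) // geq_max.
  by rewrite !szM ?cj0 // !sz_cj !leqnn.
rewrite !szM ?cj0 // sz_cj W_size spq; move: nzq w_nc; rewrite -size_poly_gt0.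
by move: (size q) (size w) => a b; lia.
Qed.

Definition qeval (y x : K) (u : A) : K := u.1.[y] + u.2.[y] * x.

Section Evaluation.
Variables (y x : K).
Hypothesis xy : x ^+ 2 = w.[y] * x - c.

Lemma qevalD : {morph qeval y x : u v / u + v}.
Proof. by move=> u v; rewrite /qeval !hornerD; ring. Qed.

Lemma qeval0 : qeval y x 0 = 0.
Proof. by rewrite /qeval !horner0 mul0r addr0. Qed.

Lemma qevalM : {morph qeval y x : u v / u * v}.
Proof.
move=> u v; rewrite /qeval quadME /= !(hornerD, hornerN, hornerM) hornerC.
set a := u.1.[y]; set a' := v.1.[y]; set b := u.2.[y]; set b' := v.2.[y].
transitivity (a * a' + (a * b' + b * a') * x + b * b' * (w.[y] * x - c)); first by ring.
by rewrite -xy; ring.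
Qed.

Lemma qevalXn u n : qeval y x (u ^+ n) = qeval y x u ^+ n.
Proof.
elim: n => [|n IH]; last by rewrite !exprS qevalM IH.
by rewrite /qeval /= hornerC horner0 mul0r addr0.
Qed.

Lemma qeval_sum (I : Type) (r : seq I) (P : pred I) (f : I -> A) :
  qeval y x (\sum_(i <- r | P i) f i) = \sum_(i <- r | P i) qeval y x (f i).
Proof. exact: (big_morph _ qevalD qeval0). Qed.

Lemma qevalY : qeval y x Y = y.
Proof. by rewrite /qeval hornerX horner0 mul0r addr0. Qed.

Lemma qevalX : qeval y x X = x.
Proof. by rewrite /qeval horner0 hornerC mul1r add0r. Qed.

End Evaluation.

(** The function is affine in x, so two distinct zeros above the same y make both of its coordinates
    vanish at y. *)
Lemma qeval_common_zeros m u (B : {set K}) : u != 0 -> qdeg_le m u ->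
  (forall y, y \in B -> exists x1 x2, [/\ x1 != x2, qeval y x1 u = 0 & qeval y x2 u = 0]) ->
  (#|B| <= m)%N.
Proof.
move=> nzu /andP[u1 u2] hB.
have zeros y : y \in B -> root u.1 y /\ root u.2 y.
  case/hB => x1 [x2 [ne e1 e2]].
  have z2 : u.2.[y] = 0.
    have : u.2.[y] * (x1 - x2) = 0 by rewrite -[RHS](subrr 0) -{1}e1 -e2 /qeval; ring.
    by move/eqP; rewrite mulf_eq0 subr_eq0 (negPf ne) orbF => /eqP.
  by move: e1; rewrite /root /qeval z2 mul0r addr0 => ->; rewrite eqxx.
have bound (p : {poly K}) : p != 0 -> (forall y, y \in B -> root p y) -> (size p <= m.+1)%N ->
    (#|B| <= m)%N.
  move=> nzp rp sp; rewrite -ltnS cardE; apply: leq_trans sp; apply: max_poly_roots => //.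
    by apply/allP => y; rewrite mem_enum; apply: rp.
  exact: enum_uniq.
have [u10|nz1] := eqVneq u.1 0; last by apply: bound u1 => // y /zeros[].
apply: (bound u.2); first by apply: contra_neq nzu => u20; case: (u) u10 u20 => a b /= -> ->.
  by move=> y /zeros[].
by apply: leq_trans u2 _; rewrite leq_subr.
Qed.

End StepanovAuxiliary.

Section StepanovBound.
Variables (K : finFieldType) (w : {poly K}) (c : K) (s : nat).
Local Notation A := (quad w c%:P).
Local Notation D := (size w).-1.
Local Notation cst := (qconst w c%:P).
Local Notation X := (qX w c%:P).
Local Notation Y := (cst 'X).

Hypotheses (nz2 : (2%:R : K) != 0) (nzc : c != 0) (w_nc : (1 < size w)%N).
Hypotheses (hs : [pchar K].-nat s) (cardK : #|K| = (s ^ 2)%N).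

Variables (l k : nat).
Hypotheses (l2 : (l.*2 < s)%N) (Dl : (D <= l.+1)%N) (Dk : (D <= k)%N).
Hypothesis room : ((l * s + k).*2 + 2 - D < (l.*2 + 2 - D) * (k.*2 + 2 - D))%N.

(** [V] gives coordinates on [qdeg_le l], a space of dimension 2 l + 2 - D, and [T] consists of the
    coefficient families of an auxiliary function. Thus [room] says that [T] has more coordinates
    than the space containing the values of [psi]. *)
Let V : finType := ('rV[K]_l.+1 * 'rV[K]_(l.+1 - D))%type.
Let T : finType := ({ffun 'I_k.+1 -> V} * {ffun 'I_(k.+1 - D) -> V})%type.

Let el (v : V) : A := (rVpoly v.1, rVpoly v.2).

Let el_inj : injective el.
Proof.
by move=> [a b] [a' b'] [e1 e2]; congr (_, _); apply: (can_inj rVpolyK).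
Qed.

Let el_le v : qdeg_le l (el v).
Proof. by rewrite /qdeg_le !size_poly. Qed.

Let coefs n (t : {ffun 'I_n -> V}) : {poly A} := \poly_(i < n) oapp (fun j => el (t j)) 0 (insub i).

Let coefs_ord n (t : {ffun 'I_n -> V}) (j : 'I_n) : (coefs t)`_j = el (t j).
Proof. by rewrite coef_poly ltn_ord valK. Qed.

Let coefs_le n (t : {ffun 'I_n -> V}) : coef_qdeg_le l (coefs t).
Proof.
move=> i; rewrite coef_poly; have [lt_in|_] := ltnP i n; first by rewrite insubT /=.
by rewrite -(rmorph0 cst) qdeg_le_cst size_poly0.
Qed.

Let coefs_horner n (t : {ffun 'I_n -> V}) z : (coefs t).[z] = \sum_j el (t j) * z ^+ j.
Proof.
rewrite (horner_coef_wide _ (size_poly _ _)).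
by apply: eq_bigr => j _; rewrite coefs_ord.
Qed.

(* [psi] lies in a small space, so it takes the same value at two distinct points;
   at points over [K], [phi ^ s = psi] because [x ^ (s ^ 2) = x]. *)
Let psi (t : T) : A :=
  \sum_j el (t.1 j) ^+ s * Y ^+ j + \sum_j el (t.2 j) ^+ s * (Y ^+ j * X).
Let phi (t : T) : A := (coefs t.1).[Y ^+ s] + (coefs t.2).[Y ^+ s] * X ^+ s.

Let psi_le t : qdeg_le (l * s + k) (psi t).
Proof.
apply: qdeg_leD; apply: qdeg_le_sum => j _.
  apply: (qdeg_leM w_nc); first exact: (qdeg_leXn w_nc).
  by apply: qdeg_leW (qdeg_leY w c j); rewrite // -ltnS.
apply: (qdeg_leM w_nc); first exact: (qdeg_leXn w_nc).
apply: qdeg_leW (qdeg_leM w_nc (qdeg_leY w c j) (qdeg_leX c w_nc)) => //.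
by case: j => j /= jk; move: (_.-1) Dk jk => d; lia.
Qed.

(** This order is the final bound on the number of zeros. The factor X^s costs D s, which the
    shorter range of the second index makes up for. *)
Let phi_le t : qdeg_le (l + k * s) (phi t).
Proof.
rewrite /phi !coefs_horner mulr_suml; apply: qdeg_leD; apply: qdeg_le_sum => j _.
  apply: (qdeg_leM w_nc) => //; rewrite -exprM.
  by apply: qdeg_leW (qdeg_leY w c _); rewrite // mulnC leq_mul2r -ltnS ltn_ord orbT.
rewrite -mulrA; apply: (qdeg_leM w_nc) => //; rewrite -exprM.
apply: qdeg_leW (qdeg_leM w_nc (qdeg_leY w c _) (qdeg_leXn w_nc s (qdeg_leX c w_nc))) => //.
rewrite [(s * _)%N]mulnC -mulnDl leq_mul2r; apply/orP; right.
by case: j => j /= jk; move: (_.-1) Dk jk => d; lia.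
Qed.

Let frobD : {morph (fun z : K => z ^+ s) : a b / a + b}.
Proof. by move=> a b; rewrite exprDn_pchar. Qed.

Let frob0 : (0 : K) ^+ s = 0.
Proof. by case/andP: hs => s_gt0 _; rewrite expr0n eqn0Ngt s_gt0. Qed.

Let qeval_phi x y t : x ^+ 2 = w.[y] * x - c -> qeval y x (phi t) ^+ s = qeval y x (psi t).
Proof.
move=> xy.
have expK (z : K) : (z ^+ s) ^+ s = z by rewrite -exprM mulnn -cardK expf_card.
have frob_sum n (f : 'I_n -> K) : (\sum_j f j) ^+ s = \sum_j f j ^+ s.
  exact: (big_morph _ frobD frob0).
have ev n (u : {ffun 'I_n -> V}) :
    qeval y x (coefs u).[Y ^+ s] ^+ s = \sum_j qeval y x (el (u j)) ^+ s * y ^+ j.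
  rewrite coefs_horner qeval_sum frob_sum; apply: eq_bigr => j _.
  by rewrite qevalM // !qevalXn // qevalY exprMn exprAC expK.
rewrite /phi qevalD qevalM // qevalXn // qevalX frobD exprMn expK !ev /psi qevalD !qeval_sum.
congr (_ + _); rewrite ?mulr_suml; apply: eq_bigr => j _.
  by rewrite qevalM // !qevalXn // qevalY.
by rewrite !qevalM // !qevalXn // qevalX qevalY mulrA.
Qed.

Let pack m (u : A) : 'rV[K]_m.+1 * 'rV[K]_(m.+1 - D) := (poly_rV u.1, poly_rV u.2).

Let pack_inj m u v : qdeg_le m u -> qdeg_le m v -> pack m u = pack m v -> u = v.
Proof.
case: u v => [a b] [a' b'] /andP[/= a1 b1] /andP[/= a1' b1'] [e1 e2].
by congr (_, _); [rewrite -(poly_rV_K a1) e1 | rewrite -(poly_rV_K b1) e2]; rewrite poly_rV_K.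
Qed.

(** The coefficients enter [psi] through their s-th powers, so [psi] is not linear over [K];
    counting elements replaces a comparison of dimensions. *)
Let collision : exists t t', t != t' /\ psi t = psi t'.
Proof.
pose N := (l * s + k)%N.
have /injectivePn[t [t' ne e]] : ~~ injectiveb (fun t => pack N (psi t)).
  apply/negP => /injectiveP/leq_card; rewrite leqNgt; apply/negP; rewrite negbK.
  have cardV : #|V| = (#|K| ^ (l.+1 + (l.+1 - D)))%N.
    by rewrite card_prod !card_mx !mul1n expnD.
  rewrite !card_prod !card_ffun !card_ord cardV !card_mx !mul1n -!expnM -!expnD.
  rewrite ltn_exp2l ?card_finNzRing_gt1 //.
  move: room Dl Dk; rewrite /N; move: (_.-1) => d; rewrite -!mulnDr => h d1 d2.
  have -> : (l.+1 + (l.+1 - d) = l.*2 + 2 - d)%N by lia.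
  have -> : (k.+1 + (k.+1 - d) = k.*2 + 2 - d)%N by lia.
  by apply: leq_trans _ h; lia.
exists t, t'; split; first exact: ne.
exact: (pack_inj (psi_le t) (psi_le t') e).
Qed.

Theorem stepanov_bound :
  (#|[set y : K | nsqrt (w.[y] ^+ 2 - c *+ 4)%R == 2]| <= l + k * s)%N.
Proof.
have [t [t' [ne e]]] := collision.
have nzG : phi t - phi t' != 0.
  apply: contraNneq ne => phi0.
  pose p := coefs t.1 - coefs t'.1; pose q := coefs t.2 - coefs t'.2.
  have le_sub n (u v : {ffun 'I_n -> V}) : coef_qdeg_le l (coefs u - coefs v).
    move=> i; rewrite coefB; apply: qdeg_leD; rewrite ?qdeg_leN; exact: coefs_le.
  have [] := no_frobenius_relation nz2 nzc w_nc hs l2 (le_sub _ t.1 t'.1) (le_sub _ t.2 t'.2).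
    by rewrite -[RHS]phi0 !hornerD !hornerN /phi; ring.
  have sub0 n (u v : {ffun 'I_n -> V}) : coefs u - coefs v = 0 -> u = v.
    move/eqP; rewrite subr_eq0 => /eqP uv; apply/ffunP => j; apply: el_inj.
    by rewrite -!coefs_ord uv.
  by case: (t) (t') => a b [a' b'] /= /sub0 -> /sub0 ->.
apply: (qeval_common_zeros nzG) => [|y].
  by apply: qdeg_leD; rewrite ?qdeg_leN phi_le.
rewrite inE => y2.
have /nsqrt_gt0P[v vE] : (0 < nsqrt (w.[y] ^+ 2 - c *+ 4)%R)%N by rewrite (eqP y2).
have nzv : v != 0.
  by apply: contraTneq y2 => v0; rewrite -vE v0 expr0n nsqrt0.
(* At such a point [psi t = psi t'] equates the s-th powers of the two values of [phi], and the s-th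
   power map is injective on [K]. *)
have zero x : x ^+ 2 = w.[y] * x - c -> qeval y x (phi t - phi t') = 0.
  move=> xy; have := qeval_phi t xy; rewrite e -(qeval_phi t' xy) => ee.
  have : (qeval y x (phi t - phi t') + qeval y x (phi t')) ^+ s = qeval y x (phi t') ^+ s.
    by rewrite -qevalD subrK.
  rewrite frobD -[X in _ = X]add0r => /addIr/eqP.
  by rewrite expf_eq0 => /andP[_ /eqP].
have nz4 : (4%:R : K) != 0 by rewrite (natrM _ 2 2) mulf_neq0.
exists ((w.[y] + v) / 2%:R), ((w.[y] - v) / 2%:R); split.
- apply: contra_neq nzv => eqx.
  transitivity ((w.[y] + v) / 2%:R - (w.[y] - v) / 2%:R); first by field.
  by rewrite eqx subrr.
- apply: zero; apply: (mulIf nz4); apply/eqP; rewrite -subr_eq0; apply/eqP.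
  transitivity (v ^+ 2 - (w.[y] ^+ 2 - c *+ 4)); last by rewrite vE subrr.
  by field.
- apply: zero; apply: (mulIf nz4); apply/eqP; rewrite -subr_eq0; apply/eqP.
  transitivity (v ^+ 2 - (w.[y] ^+ 2 - c *+ 4)); last by rewrite vE subrr.
  by field.
Qed.
End StepanovBound.

(** * Weil's bound for Kloosterman sums *)

Lemma pchar_nat_card (F : finFieldType) : [pchar F].-nat #|F|.
Proof.
have [p p_pr pF] := finPcharP F.
by rewrite (eq_pnat _ (pcharf_eq pF)) -cardsT; apply: (pprimeChar_pgroup pF).
Qed.

Lemma odd_card_neq0 (F : finFieldType) : odd #|F| -> (2%:R : F) != 0.
Proof.
move=> oddF; apply: contraTneq (card_finNzRing_gt1 F) => /eqP two0.
have p2 : 2%N \in [pchar F] by rewrite inE two0.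
have := pchar_nat_card F; rewrite (eq_pnat _ (pcharf_eq p2)) => F2.
by rewrite (pnat_1 F2) // -odd_2'nat.
Qed.

Section KloostermanCount.
Variables (F : finFieldType) (c : F).
Hypotheses (nz2 : (2%:R : F) != 0) (nzc : c != 0).

(** The equation on x is x^2 - u x + c = 0, and v = 2 x - u is a root of its discriminant. *)
Lemma nsqrt_disc u : nsqrt (u ^+ 2 - c *+ 4) = #|[set x | (x != 0) && (x + c / x == u)]|.
Proof.
have hI : injective (fun v => (u + v) / 2%:R).
  by move=> v v' /(mulIf _) /= e; apply: (addrI u); apply: e; rewrite invr_eq0.
rewrite /nsqrt -(card_imset _ hI); congr #|pred_of_set _|.
apply/setP => x; rewrite inE; apply/imsetP/andP => [[v]|[nzx /eqP <-]].
  rewrite inE => /eqP vE ->.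
  have e : ((u + v) / 2%:R) * (u - (u + v) / 2%:R) = c.
    have nz4 : (4%:R : F) != 0 by rewrite (natrM _ 2 2) mulf_neq0.
    apply: (mulIf nz4); apply/eqP; rewrite -subr_eq0; apply/eqP.
    transitivity (u ^+ 2 - c *+ 4 - v ^+ 2); last by rewrite vE subrr.
    by field.
  have nzx : (u + v) / 2%:R != 0 by apply: contraNneq nzc => x0; rewrite -e x0 mul0r.
  by split=> //; rewrite -[in c / _]e [_ * (u - _)]mulrC mulfK // addrC subrK.
exists (x - c / x); last by field; rewrite nz2 nzx.
by rewrite inE; apply/eqP; field.
Qed.

Lemma sum_nsqrt_disc : (\sum_u nsqrt (u ^+ 2 - c *+ 4)%R = #|F|.-1)%N.
Proof.
under eq_bigr do rewrite nsqrt_disc.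
by rewrite -(card_sum_fibers (fun x => x != 0) (fun x => x + c / x)) cardC1.
Qed.

Lemma kloosterman_nsqrt psi :
  kloosterman psi c = \sum_u psi u * (nsqrt (u ^+ 2 - c *+ 4))%:R.
Proof.
rewrite /kloosterman (partition_big (fun x => x + c / x) predT) //=.
apply: eq_bigr => u _; rewrite nsqrt_disc mulr_natr -sumr_const big_set /=.
by apply: eq_bigr => x /andP[_ /eqP ->].
Qed.

End KloostermanCount.

Lemma nsqrt_le (F : finFieldType) (x : F) : (2%:R : F) != 0 ->
  (nsqrt x <= (nsqrt x == 2) * 2 + (x == 0%R))%N.
Proof.
move=> nz2; have [->|nzx] := eqVneq x 0; first by rewrite nsqrt0.
have := nsqrt_le2 x; case: (posnP (nsqrt x)) => [-> //|/nsqrt_gt0P[v vE]].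
suff : (2 <= nsqrt x)%N by move: (nsqrt x) => [|[|[|n]]].
have nv : v != - v.
  rewrite -subr_eq0 opprK -mulr2n -mulr_natr mulf_neq0 //.
  by apply: contraNneq nzx => v0; rewrite -vE v0 expr0n.
have <- : #|[set v; - v]| = 2%N by rewrite cards2 nv.
apply/subset_leq_card/subsetP => u; rewrite !inE => /orP[]/eqP ->; rewrite ?sqrrN vE //.
Qed.

(* Since psi (y ^ D - y) = 1, averaging over translates by y ^ D - y writes the sum as
   a sum over b of psi b times the number of points of v ^ 2 = (y ^ D - y + b) ^ 2 - 4 c;
   upper bounds on these numbers suffice because their total is known. *)
Lemma kloosterman_le_stepanov (F : finFieldType) (psi : F -> algC) (c : F) (s D : nat) :
  addchar psi -> odd #|F| -> c != 0 -> #|F| = (s ^ 2)%N -> (1 < D)%N ->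
  (D ^ 2 + D < s.*2)%N -> (forall y, psi (y ^+ D) = psi y) ->
  `|kloosterman psi c| <= (8 * D * s + 1)%:R.
Proof.
move=> psiP oddF nzc cardF D1 Ds psiD.
have nz2 := odd_card_neq0 oddF.
have s_odd : odd s by move: oddF; rewrite cardF oddX.
have hs : [pchar F].-nat s.
  by apply: pnat_dvd (pchar_nat_card F); rewrite cardF dvdn_exp.
pose M (b : F) := (\sum_y nsqrt ((y ^+ D - y + b) ^+ 2 - c *+ 4)%R)%N.
have M_le b : (M b <= #|F| + 4 * D * s)%N.
  pose w : {poly F} := 'X^D - 'X + b%:P.
  have wE y : w.[y] = y ^+ D - y + b by rewrite !hornerE.
  have szw : size w = D.+1.
    have -> : w = 'X^D - ('X - b%:P) by rewrite /w; ring.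
    by rewrite size_polyDl size_polyXn // size_polyN size_XsubC.
  have szw2 : size (w ^+ 2 - (c *+ 4)%:P) = (D.*2).+1.
    have szsq : size (w ^+ 2) = (D.*2).+1.
      have nzw : w != 0 by rewrite -size_poly_eq0 szw.
      by rewrite expr2 size_mul // szw addSn addnS addnn.
    by rewrite size_polyDl // szsq size_polyN size_polyC; case: (_ != _); lia.
  have zeros : (#|[set y | (w ^+ 2 - (c *+ 4)%:P).[y] == 0%R]| <= D.*2)%N.
    rewrite -ltnS -szw2 cardE; apply: max_poly_roots; rewrite -?size_poly_eq0 ?szw2 ?enum_uniq //.
    by apply/allP => y; rewrite mem_enum inE.
  (* As s is odd, this choice turns [room] into s^2 + D + 1 < (s + 1 - D)(s + 1 + D), which is
     exactly D^2 + D < 2 s. Twice the resulting bound is s^2 plus O(D s), with the right main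
     term. *)
  have := @stepanov_bound F w c s nz2 nzc _ hs cardF s./2 (s./2 + D).
  rewrite szw /= => /(_ _ _ _ _ _) bound.
  have {}bound : (#|[set y | nsqrt (w.[y] ^+ 2 - c *+ 4)%R == 2]| <= s./2 + (s./2 + D) * s)%N.
    by apply: bound; move: s_odd Ds; rewrite ?doubleK; nia.
  apply: (@leq_trans (\sum_y ((nsqrt (w.[y] ^+ 2 - c *+ 4)%R == 2) * 2 + (w.[y] ^+ 2 - c *+ 4 == 0)%R))%N).
    by apply: leq_sum => y _; rewrite -wE nsqrt_le.
  have cardE (P : pred F) : (\sum_y P y = #|[set y | P y]|)%N.
    by rewrite -sum1dep_card [RHS]big_mkcond; apply: eq_bigr => y _; case: (P y).
  rewrite big_split /= -big_distrl /= !cardE.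
  have -> : [set y | w.[y] ^+ 2 - c *+ 4 == 0] = [set y | (w ^+ 2 - (c *+ 4)%:P).[y] == 0].
    by apply/setP => y; rewrite !inE !hornerE.
  move: bound zeros; move: #|_| #|_| => n1 n2; rewrite cardF.
  by move: s_odd D1; rewrite -[s in odd s]odd_double_half; nia.
have M_sum : (\sum_b M b = #|F| * #|F|.-1)%N.
  rewrite exchange_big /= -sum_nat_const; apply: eq_bigr => y _.
  rewrite -(sum_nsqrt_disc nz2 nzc) [RHS](reindex_inj (addrI (y ^+ D - y))).
  by apply: eq_bigr => b _.
have K_M : #|F|%:R * kloosterman psi c = \sum_b psi b * ((M b)%:R - #|F|%:R).
  under eq_bigr do rewrite mulrBr.
  rewrite sumrB -[X in _ - X]mulr_suml (sum_addchar psiP) mul0r subr0.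
  under eq_bigr do rewrite natr_sum mulr_sumr.
  rewrite exchange_big /= mulr_natl -sumr_const; apply: eq_bigr => y _.
  rewrite kloosterman_nsqrt // (reindex_inj (addrI (y ^+ D - y))) /=.
  apply: eq_bigr => b _; congr (_ * _).
  rewrite addcharD // -[RHS]mul1r; congr (_ * _).
  by rewrite addcharD // psiD -addcharD // subrr addchar0.
have q_gt0 : 0 < #|F|%:R :> algC by rewrite ltr0n (leq_trans _ (card_finNzRing_gt1 F)).
rewrite -(ler_pM2l q_gt0) -{1}[#|F|%:R]normr_nat -normrM K_M.
apply: le_trans (ler_norm_sum _ _ _) _.
pose B : algC := (4 * D * s)%:R.
(* A real number z <= B with B >= 0 satisfies |z| <= 2 B - z. The deviations of [M] sum to -q, which
   produces the 1 in 2 B + 1. *)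
apply: (@le_trans _ _ (\sum_b (2 * B - ((M b)%:R - #|F|%:R)))).
  apply: ler_sum => b _; rewrite normrM norm_addchar // mul1r.
  have M_leB : (M b)%:R - #|F|%:R <= B by rewrite lerBlDl -natrD ler_nat.
  have B0 : 0 <= B by apply: ler0n.
  have Mreal : ((M b)%:R - #|F|%:R : algC) \is Num.real by rewrite realB ?realn.
  have [M0|M0] := real_ge0P Mreal.
    by rewrite lerBrDl mulr_natl mulr2n lerD.
  by rewrite lerBrDl subrr mulr_ge0 // ler0n.
rewrite sumrB sumrB !sumr_const -natr_sum M_sum -[(#|F|%:R : algC) *+ _]mulr_natl -[(2 * B) *+ _]mulr_natl.
have -> : (#|F| * #|F|.-1)%:R = #|F|%:R * (#|F|%:R - 1) :> algC.
  by rewrite natrM -subn1 natrB // (leq_trans _ (card_finNzRing_gt1 F)).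
rewrite le_eqVlt; apply/orP; left; apply/eqP.
have -> : (8 * D * s + 1)%:R = 2 * B + 1 :> algC.
  by rewrite /B natrD -natrM; congr ((_)%:R + _); lia.
by ring.
Qed.

Lemma quad_pcharP (R : comNzRingType) (w c : R) n :
  [pchar R].-nat n -> [pchar quad w c].-nat n.
Proof. by apply: sub_in_pnat => p _; apply: (rmorph_pchar (qconst w c)). Qed.

Lemma qtraceX_pchar (R : comNzRingType) (w c : R) (u : quad w c) n :
  [pchar R].-nat n -> qtrace (u ^+ n) = qtrace u ^+ n.
Proof.
move=> hn; suff : qconst w c (qtrace (u ^+ n)) = qconst w c (qtrace u ^+ n) by case.
by rewrite rmorphXn /= !qtraceE qconjX exprDn_pchar // quad_pcharP.
Qed.

(** What is preserved along the tower. [D] is a power of the characteristic that never changes: the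
    trace commutes with the D-th power, so invariance of the character passes to the extension. *)
Definition kloosterman_datum (D : nat) (F : finFieldType) (psi : F -> algC) (c : F) : Prop :=
  [/\ addchar psi, odd #|F|, c != 0, [pchar F].-nat D & forall y, psi (y ^+ D) = psi y].

Lemma kloosterman_datum_quad D (F : finFieldType) (psi : F -> algC) (c : F)
    (m : {m : F | nsqrt m == 0%N}) : kloosterman_datum D psi c ->
  kloosterman_datum D (@addchar_quad F psi m) (quadf_const m c).
Proof.
move=> [psiP oddF nzc hD psiD]; have nz2 := odd_card_neq0 oddF; split.
- exact: addchar_quadP.
- by rewrite card_quadf oddX oddF.
- by apply/eqP => -[c0]; rewrite c0 eqxx in nzc.
- exact: (@quad_pcharP F 0 (- val m)).
move=> y; rewrite /addchar_quad.
have tr (z : quadf m) : quadf_trace z = qtrace (z : quad 0 (- val m)).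
  by rewrite /qtrace mulr0 addr0.
by rewrite !tr (qtraceX_pchar (y : quad 0 (- val m)) hD) psiD.
Qed.

(** The new sum is 2 q - K^2, whose square is at least ((2 + delta) q)^2 >= (4 + 4 delta) q^2. *)
Lemma kloosterman_amplify D (F : finFieldType) (psi : F -> algC) (c : F) (delta : algC) :
  kloosterman_datum D psi c -> 0 <= delta ->
  (4 + delta) * #|F|%:R <= kloosterman psi c ^+ 2 ->
  exists (F' : finFieldType) (psi' : F' -> algC) (c' : F'),
    [/\ kloosterman_datum D psi' c', #|F'| = (#|F| ^ 2)%N
      & (4 + 4 * delta) * #|F'|%:R <= kloosterman psi' c' ^+ 2].
Proof.
move=> dat d0 le; have [psiP oddF nzc _ _] := dat.
have nz2 := odd_card_neq0 oddF.
have [m0 /eqP m0P] := exists_nonsquare nz2; pose m : {m : F | nsqrt m == 0%N} := exist _ m0 m0P.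
exists (quadf m), (@addchar_quad F psi m), (quadf_const m c); split.
- exact: kloosterman_datum_quad.
- exact: card_quadf.
have := kloosterman_quad m psiP nz2 nzc; set k' := kloosterman _ (quadf_const _ _) => e.
have -> : k' = - (kloosterman psi c ^+ 2 - 2 * #|F|%:R) by rewrite -e; ring.
set k2 := kloosterman psi c ^+ 2 in le *; set q : algC := #|F|%:R in le *.
have q0 : 0 <= q by apply: ler0n.
rewrite card_quadf natrX -/q sqrrN.
have le2 : (2 + delta) * q <= k2 - 2 * q.
  by rewrite lerBrDr -mulrDl; apply: le_trans le; rewrite addrAC -natrD.
have : ((2 + delta) * q) ^+ 2 <= (k2 - 2 * q) ^+ 2.
  have n0 : 0 <= (2 + delta) * q by rewrite mulr_ge0 // addr_ge0 // ler0n.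
  by rewrite lerXn2r // nnegrE // (le_trans n0).
apply: le_trans; rewrite exprMn ler_wpM2r ?exprn_ge0 //.
have -> : (2 + delta) ^+ 2 = 4 + 4 * delta + delta ^+ 2 by ring.
by rewrite lerDl exprn_ge0.
Qed.

Lemma kloosterman_amplify_iter n D (F : finFieldType) (psi : F -> algC) (c : F) (delta : algC) :
  kloosterman_datum D psi c -> 0 <= delta ->
  (4 + delta) * #|F|%:R <= kloosterman psi c ^+ 2 ->
  exists (F' : finFieldType) (psi' : F' -> algC) (c' : F'),
    [/\ kloosterman_datum D psi' c', #|F'| = (#|F| ^ (2 ^ n))%N
      & (4 + 4 ^+ n * delta) * #|F'|%:R <= kloosterman psi' c' ^+ 2].
Proof.
elim: n F psi c delta => [|n IH] F psi c delta dat d0 le.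
  by exists F, psi, c; rewrite expr0 mul1r expn1.
have [F1 [psi1 [c1 [dat1 card1 le1]]]] := kloosterman_amplify dat d0 le.
have d1 : 0 <= 4 * delta by rewrite mulr_ge0 // ler0n.
have [F2 [psi2 [c2 [dat2 card2 le2]]]] := IH _ _ _ _ dat1 d1 le1.
exists F2, psi2, c2; split=> //; first by rewrite card2 card1 -expnM -expnS.
by rewrite exprSr -mulrA.
Qed.

Theorem kloosterman_weil (F : finFieldType) (psi : F -> algC) (c : F) :
  addchar psi -> odd #|F| -> c != 0 -> `|kloosterman psi c| ^+ 2 <= 4 * #|F|%:R.
Proof.
move=> psiP oddF nzc; pose q := #|F|.
have K2 : `|kloosterman psi c| ^+ 2 = kloosterman psi c ^+ 2.
  by rewrite normCK kloosterman_real // expr2.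
have q_gt0 : 0 < q%:R :> algC by rewrite ltr0n (leq_trans _ (card_finNzRing_gt1 F)).
have dat : kloosterman_datum q psi c.
  by split=> //; [exact: pchar_nat_card | move=> y; rewrite expf_card].
have real2 : kloosterman psi c ^+ 2 \is Num.real by rewrite -K2 realX ?normr_real.
have real4 : (4 * q%:R : algC) \is Num.real by rewrite -natrM realn.
rewrite K2 real_leNgt //; apply/negP => gt.
pose delta := kloosterman psi c ^+ 2 / q%:R - 4.
have d_gt0 : 0 < delta by rewrite subr_gt0 ltr_pdivlMr.
have le : (4 + delta) * #|F|%:R <= kloosterman psi c ^+ 2.
  by rewrite addrC subrK divfK ?gt_eqF.
(* The Stepanov bound 8 q s + 1 is at most 9 q s, so 4^n delta has to exceed 81 q^2. The extra 3
   gives s >= q^4, hence q^2 + q < 2 s. *)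
pose n := (Num.bound (81 * q%:R ^+ 2 / delta)).+3.
have [F' [psi' [c' [dat' card' le']]]] := kloosterman_amplify_iter n dat (ltW d_gt0) le.
have [psiP' oddF' nzc' _ psiD'] := dat'.
pose s := (q ^ (2 ^ n.-1))%N.
have cards : #|F'| = (s ^ 2)%N by rewrite card' -expnM -expnSr.
have q3 : (2 < q)%N.
  by rewrite /q; move: oddF (card_finNzRing_gt1 F); case: #|F| => [|[|[|]]].
have Ds : (q ^ 2 + q < s.*2)%N.
  have q4 : (q ^ 4 <= s)%N by rewrite leq_exp2l ?(ltnW q3) // /n /= (@leq_exp2l 2 2).
  rewrite -addnn; apply: leq_trans (leq_trans q4 (leq_addr s s)).
  by move: q3; clear; rewrite !expnS expn0; nia.
have := kloosterman_le_stepanov psiP' oddF' nzc' cards (ltnW q3) Ds psiD'.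
set K := kloosterman psi' c' in le' * => leK.
have leK9 : `|K| <= 9 * q%:R * s%:R.
  apply: le_trans leK _; rewrite -!natrM ler_nat.
  have : (0 < q * s)%N by rewrite muln_gt0 expn_gt0 (ltnW (ltnW q3)).
  by rewrite -!mulnA; move: (q * s)%N; clear => a; lia.
have : K ^+ 2 <= 81 * q%:R ^+ 2 * #|F'|%:R.
  have -> : K ^+ 2 = `|K| ^+ 2 by rewrite normCK kloosterman_real // expr2.
  have -> : 81 * q%:R ^+ 2 * #|F'|%:R = (9 * q%:R * s%:R) ^+ 2 :> algC.
    by rewrite cards natrX !exprMn; ring.
  by rewrite lerXn2r ?nnegrE // !mulr_ge0 ?ler0n.
have q'_gt0 : 0 < #|F'|%:R :> algC by rewrite ltr0n (leq_trans _ (card_finNzRing_gt1 F')).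
move/(le_trans le'); rewrite ler_pM2r // => bad.
have : 4 ^+ n * delta <= 81 * q%:R ^+ 2 by apply: le_trans bad; rewrite lerDr ler0n.
rewrite -ler_pdivlMr // => bad2.
have b_ge0 : 0 <= 81 * q%:R ^+ 2 / delta by rewrite divr_ge0 ?(ltW d_gt0) // mulr_ge0 ?exprn_ge0 ?ler0n.
have := le_lt_trans bad2 (archi_boundP b_ge0).
rewrite -natrX ltr_nat ltnNge; apply/negP; rewrite negbK.
apply: (@leq_trans n); last exact: ltnW (ltn_expl _ _).
by do 3 apply: leqW.
Qed.

(** * Gauss and Salie sums *)

Section GaussSums.
Variables (F : finFieldType) (psi : F -> algC).
Hypotheses (psiP : addchar psi) (nz2 : (2%:R : F) != 0).
Local Notation q := (#|F|%:R : algC).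

Definition gauss (s : F) : algC := \sum_x psi (s * x ^+ 2).

Lemma gaussM2 s y : y != 0 -> gauss (s * y ^+ 2) = gauss s.
Proof.
move=> nzy; rewrite /gauss [RHS](reindex_inj (mulfI nzy)).
by apply: eq_bigr => x _ /=; congr psi; ring.
Qed.

Lemma gauss_complete_square s m : s != 0 ->
  \sum_x psi (s * x ^+ 2 + m * x) = psi (- (m ^+ 2 / (s *+ 4))) * gauss s.
Proof.
move=> nzs; rewrite /gauss mulr_sumr [RHS](reindex_inj (addIr (m / (s *+ 2)))).
have nz4 : (4%:R : F) != 0 by rewrite (natrM _ 2 2) mulf_neq0.
apply: eq_bigr => x _; rewrite -addcharD //; congr psi; field.
by rewrite ?nz2 ?nzs ?nz4.
Qed.

(** The sign is the quadratic character of t. For a nonsquare t the values t x^2 and x^2 together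
    cover every element twice, so the two Gauss sums add up to 0. *)
Lemma gaussM t : t != 0 -> exists b : bool, forall s, s != 0 -> gauss (t * s) = (-1) ^+ b * gauss s.
Proof.
move=> nzt; have [/nsqrt_gt0P[v vt]|] := boolP (0 < nsqrt t)%N.
  exists false => s _; rewrite mul1r mulrC -vt gaussM2 //.
  by apply: contraNneq nzt => v0; rewrite -vt v0 expr0n.
rewrite -eqn0Ngt => /eqP t0; exists true => s nzs; rewrite expr1 mulN1r.
apply/eqP; rewrite -addr_eq0; apply/eqP.
have -> : gauss (t * s) = \sum_x (nsqrt (t * x))%:R * psi (s * x).
  rewrite [RHS](reindex_inj (mulfI nzt)) /gauss.
  rewrite (eq_bigr (fun x => (fun y => psi (s * (t * y))) (x ^+ 2))) => [|x _]; last first.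
    by congr psi; ring.
  rewrite (sum_sqr (fun y => psi (s * (t * y)))); apply: eq_bigr => x _.
  have -> : t * (t * x) = x * t ^+ 2 by ring.
  by rewrite nsqrtM2.
rewrite /gauss (sum_sqr (fun y => psi (s * y))) -big_split /=.
rewrite (eq_bigr (fun x => 2 * psi (s * x))) => [|x _]; last first.
  by rewrite -mulrDl -natrD addnC nsqrt_nonsquare.
by rewrite -mulr_sumr sum_addcharM // (negPf nzs) mulr0n mulr0.
Qed.

Lemma norm_gauss1 : `|gauss 1| ^+ 2 = q.
Proof.
rewrite normCK rmorph_sum /gauss big_distrlr /= exchange_big /=.
rewrite (eq_bigr (fun y => \sum_h psi (h ^+ 2) * psi ((h *+ 2) * y))) => [|y _]; last first.
  rewrite (reindex_inj (addIr y)); apply: eq_bigr => h _ /=.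
  by rewrite conj_addchar // -!addcharD //; congr psi; ring.
have sum_h h : \sum_y psi (h ^+ 2) * psi ((h *+ 2) * y) = q *+ (h == 0).
  rewrite -mulr_sumr sum_addcharM //.
  have -> : (h *+ 2 == 0) = (h == 0) by rewrite -mulr_natr mulf_eq0 (negPf nz2) orbF.
  by case: eqP => [->|_]; rewrite ?expr0n ?addchar0 ?mul1r // mulr0n mulr0.
rewrite exchange_big /=; under eq_bigr do rewrite sum_h.
by rewrite (bigD1 0) //= eqxx big1 ?addr0 // => h /negPf ->.
Qed.

Lemma gaussXeven s n : s != 0 -> gauss s ^+ n.*2 = gauss 1 ^+ n.*2.
Proof.
move=> nzs; have [b /(_ 1)] := gaussM nzs.
rewrite mulr1 => -> //; last exact: oner_neq0.
by rewrite exprMn -exprM -signr_odd oddM odd_double andbF mul1r.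
Qed.

Lemma norm_gauss1Xeven n : `|gauss 1 ^+ n.*2| = q ^+ n.
Proof. by rewrite -muln2 mulnC exprM normrX normrX norm_gauss1. Qed.

(** Unlike a Kloosterman sum, a Salie sum can be evaluated. After s -> 1 / (t s) the Gauss factor is
    [gauss s] up to a fixed sign, and psi (-1 / s) times it is the sum over x of psi (s x^2 + 2 x),
    a square completed backwards. Summing over s then leaves the solutions of x^2 = mu t / 4, at
    most two, each of weight q. *)
Lemma salie_bound (t mu : F) : t != 0 ->
  `|\sum_(s | s != 0) psi (- (t * s) - mu / (s *+ 4)) * gauss s| <= 2 * q.
Proof.
move=> nzt; have nz4 : (4%:R : F) != 0 by rewrite (natrM _ 2 2) mulf_neq0.
have [b gb] := gaussM nzt.
have invI : injective (fun s : F => (t * s)^-1) by move=> x y /invr_inj/(mulfI nzt).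
rewrite (reindex_inj invI) /=.
rewrite (eq_big (fun s => s != 0) (fun s => (-1) ^+ b *
    \sum_x psi (2%:R * x) * psi ((x ^+ 2 - mu * t / 4%:R) * s))); last first.
- move=> s; rewrite invr_eq0 mulf_eq0 (negPf nzt) /= => nzs.
  have -> : gauss (t * s)^-1 = (-1) ^+ b * gauss s.
    rewrite -gb // -[in RHS](gaussM2 _ (y := (t * s)^-1)) ?invr_eq0 ?mulf_neq0 //.
    by congr gauss; field; rewrite ?nzs ?nzt.
  rewrite mulrCA; congr (_ * _).
  have -> : - (t * (t * s)^-1) - mu / ((t * s)^-1 *+ 4) =
      - (mu * t / 4%:R * s) - 2%:R ^+ 2 / (s *+ 4).
    by field; rewrite ?nzs ?nzt ?nz4 ?nz2.
  rewrite addcharD // -[_ * gauss s]mulrA -gauss_complete_square // mulr_sumr.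
  by apply: eq_bigr => x _; rewrite -!addcharD //; congr psi; ring.
- by move=> s; rewrite invr_eq0 mulf_eq0 (negPf nzt).
rewrite -mulr_sumr normrM normrX normrN1 expr1n mul1r exchange_big /=.
under eq_bigr do rewrite -mulr_sumr sum_addcharM_neq0 // mulrBr mulr1.
rewrite sumrB sum_addcharM // (negPf nz2) mulr0n subr0.
apply: le_trans (ler_norm_sum _ _ _) _.
rewrite (eq_bigr (fun x => if x ^+ 2 == mu * t / 4%:R then q else 0)) => [|x _]; last first.
  rewrite normrM norm_addchar // mul1r subr_eq0.
  by case: eqP => _; rewrite ?mulr1n ?normr_nat // mulr0n normr0.
rewrite -big_mkcond sumr_const -[X in X <= _]mulr_natl ler_wpM2r ?ler0n // ler_nat.
by rewrite (leq_trans _ (nsqrt_le2 (mu * t / 4%:R))) // /nsqrt cardsE.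
Qed.


(** Even powers of [gauss s] do not depend on s, because the sign squares to 1; they factor out and
    leave exponent 0 or 1. *)
Lemma twisted_gauss_sum_bound (n : nat) (t mu : F) : odd #|F| -> t != 0 ->
  `|\sum_(s | s != 0) psi (- (t * s) - mu / (s *+ 4)) * gauss s ^+ n| ^+ 2 <= 4 * q ^+ n.+1.
Proof.
move=> oddF nzt; have nz4 : (4%:R : F) != 0 by rewrite (natrM _ 2 2) mulf_neq0.
rewrite -{1}[n]odd_double_half addnC.
rewrite (eq_bigr (fun s => gauss 1 ^+ n./2.*2 *
    (psi (- (t * s) - mu / (s *+ 4)) * gauss s ^+ odd n))) => [|s nzs]; last first.
  by rewrite exprD gaussXeven // mulrCA.
rewrite -mulr_sumr normrM exprMn norm_gauss1Xeven -exprM muln2.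
have q0 : 0 <= q by apply: ler0n.
have -> : 4 * q ^+ n.+1 = q ^+ n./2.*2 * (4 * q ^+ (odd n).+1).
  by rewrite mulrCA -exprD addnS addnC odd_double_half.
apply: ler_wpM2l; first exact: exprn_ge0.
case: (odd n).
  have -> : 4 * q ^+ 2 = (2 * q) ^+ 2 by rewrite exprMn; congr (_ * _); rewrite -natrX.
  by rewrite lerXn2r ?nnegrE ?normr_ge0 ?mulr_ge0 ?ler0n ?salie_bound.
under eq_bigr do rewrite expr0 mulr1.
have invI : injective (fun s : F => - s / t).
  by move=> x y /(mulIf _) e; apply: oppr_inj; apply: e; rewrite invr_eq0.
rewrite (reindex_inj invI) /=.
rewrite (eq_big (fun s => s != 0) (fun s => psi (s + (mu * t / 4%:R) / s))); last first.
- move=> s; rewrite mulf_eq0 invr_eq0 oppr_eq0 (negPf nzt) orbF => nzs; congr psi.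
  by field; rewrite oppr_eq0 nzs nzt nz4.
- by move=> s; rewrite mulf_eq0 invr_eq0 oppr_eq0 (negPf nzt) orbF.
rewrite -/(kloosterman psi _).
(* For mu = 0 the Kloosterman sum degenerates to the sum of psi over nonzero elements, which is
   -1. *)
have [->|nzmu] := eqVneq mu 0; last first.
  by rewrite expr1 kloosterman_weil // !mulf_neq0 // invr_eq0.
rewrite /kloosterman !mul0r.
rewrite (eq_bigr (fun x => psi (1 * x))) => [|x _]; last by rewrite mul0r addr0 mul1r.
rewrite sum_addcharM_neq0 // oner_eq0 mulr0n sub0r normrN1 expr1n expr1.
by rewrite -natrM ler1n muln_gt0 /= (leq_trans _ (card_finNzRing_gt1 F)).
Qed.
End GaussSums.

(** * Discrepancy of the distance and product graphs *)

Lemma sum_row_prod (F : finFieldType) (d : nat) (f : 'I_d -> F -> algC) :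
  \sum_(z : 'rV[F]_d) \prod_i f i (z 0 i) = \prod_i \sum_a f i a.
Proof.
rewrite bigA_distr_bigA /= (reindex (fun u : {ffun 'I_d -> F} => \row_i u i)) /=.
  by apply: eq_bigr => u _; apply: eq_bigr => i _; rewrite mxE.
apply: onW_bij; exists (fun z : 'rV[F]_d => [ffun i => z 0 i] : {ffun 'I_d -> F}) => [u|z].
  by apply/ffunP => i; rewrite ffunE mxE.
by apply/rowP => i; rewrite mxE ffunE.
Qed.

Section Fourier.
Variables (F : finFieldType) (psi : F -> algC) (d : nat).
Hypothesis psiP : addchar psi.
Local Notation q := (#|F|%:R : algC).
Local Notation V := 'rV[F]_d.

Lemma dotprodDl (x y z : V) : dotprod (x + y) z = dotprod x z + dotprod y z.
Proof. by rewrite -big_split; apply: eq_bigr => i _; rewrite mxE mulrDl. Qed.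

Lemma dotprodC (x y : V) : dotprod x y = dotprod y x.
Proof. by apply: eq_bigr => i _; rewrite mulrC. Qed.

Lemma dotprodDr (x y z : V) : dotprod z (x + y) = dotprod z x + dotprod z y.
Proof. by rewrite dotprodC dotprodDl ![dotprod _ z]dotprodC. Qed.

Lemma dotprodNr (x y : V) : dotprod x (- y) = - dotprod x y.
Proof. by rewrite -sumrN; apply: eq_bigr => i _; rewrite mxE mulrN. Qed.

Lemma sum_addchar_dotprod (z : V) : \sum_m psi (dotprod m z) = q ^+ d *+ (z == 0).
Proof.
rewrite (eq_bigr (fun m : V => \prod_i psi (z 0 i * m 0 i))) => [|m _]; last first.
  by rewrite addchar_sum //; apply: eq_bigr => i _; rewrite mulrC.
rewrite (sum_row_prod (fun i a => psi (z 0 i * a))).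
under eq_bigr do rewrite sum_addcharM //.
have [->|nzz] := eqVneq z 0.
  by under eq_bigr do rewrite mxE eqxx; rewrite prodr_const card_ord.
have [i nzi] : exists i, z 0 i != 0.
  apply/existsP; apply: contraNT nzz => /existsPn h; apply/eqP/rowP => i.
  by rewrite mxE; apply/eqP; have := h i; rewrite negbK.
by rewrite (bigD1 i) //= (negPf nzi) mulr0n mul0r.
Qed.

Definition fourier (g : V -> algC) (m : V) := \sum_x g x * psi (dotprod m x).

Lemma parseval (g : V -> algC) :
  \sum_m `|fourier g m| ^+ 2 = q ^+ d * \sum_x `|g x| ^+ 2.
Proof.
rewrite (eq_bigr (fun m => \sum_x \sum_y (g x * (g y)^* ) * psi (dotprod m (x - y)))); last first.
  move=> m _; rewrite normCK /fourier rmorph_sum big_distrlr /=.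
  apply: eq_bigr => x _; apply: eq_bigr => y _.
  by rewrite rmorphM /= conj_addchar // dotprodDr dotprodNr addcharD // mulrACA.
rewrite exchange_big mulr_sumr /=; apply: eq_bigr => x _.
rewrite exchange_big (bigD1 x) //= -mulr_sumr sum_addchar_dotprod subrr eqxx normCK.
rewrite big1 ?addr0 => [|y ne]; first by rewrite mulrC.
by rewrite -mulr_sumr sum_addchar_dotprod subr_eq0 eq_sym (negPf ne) mulr0n mulr0.
Qed.

Lemma fourier_conv (B : {set V}) (k : V -> algC) m :
  fourier (fun x => \sum_(y in B) k (x - y)) m =
  fourier (fun y => (y \in B)%:R) m * fourier k m.
Proof.
rewrite /fourier; under eq_bigr do rewrite mulr_suml.
rewrite exchange_big /= mulr_suml [RHS](bigID (mem B)) /= [X in _ + X]big1 ?addr0; last first.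
  by move=> y /negPf ->; rewrite !mul0r.
apply: eq_bigr => y yB; rewrite yB mul1r mulr_sumr (reindex_inj (addIr y)).
apply: eq_bigr => x _ /=.
by rewrite addrK dotprodDr addcharD //; ring.
Qed.

Lemma convolution_bound (B : {set V}) (k : V -> algC) (C : algC) :
  (forall m, `|fourier k m| ^+ 2 <= C) ->
  \sum_x `|\sum_(y in B) k (x - y)| ^+ 2 <= C * #|B|%:R.
Proof.
move=> hC; have qd_gt0 : 0 < q ^+ d.
  by rewrite exprn_gt0 // ltr0n (leq_trans _ (card_finNzRing_gt1 F)).
rewrite -(ler_pM2l qd_gt0) -parseval.
rewrite (eq_bigr (fun m => `|fourier (fun y => (y \in B)%:R) m| ^+ 2 * `|fourier k m| ^+ 2)); last first.
  by move=> m _; rewrite fourier_conv normrM exprMn.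
apply: (@le_trans _ _ (\sum_m `|fourier (fun y => (y \in B)%:R) m| ^+ 2 * C)).
  by apply: ler_sum => m _; rewrite ler_wpM2l ?exprn_ge0.
rewrite -mulr_suml parseval mulrAC -mulrA; apply: ler_wpM2l; first exact: ltW.
rewrite le_eqVlt; apply/orP; left; apply/eqP; congr (_ * _).
rewrite (bigID (mem B)) /= [X in _ + X]big1 ?addr0; last first.
  by move=> y /negPf ->; rewrite normr0 expr0n.
under eq_bigr => y yB do rewrite yB normr1 expr1n.
by rewrite sumr_const.
Qed.
End Fourier.

Lemma sum_addchar_count (F : finFieldType) (psi : F -> algC) (I : finType) (B : {set I}) (h : I -> F) :
  addchar psi -> \sum_(y in B) \sum_(s | s != 0) psi (h y * s) =
    ((#|F| * #|[set y in B | h y == 0]|)%:Z - #|B|%:Z)%:~R.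
Proof.
move=> psiP; under eq_bigr do rewrite sum_addcharM_neq0 // mulrb.
by rewrite sumrB -big_mkcondr !sumr_const rmorphB /= -mulrnA cardsE.
Qed.

Section DistanceGraph.
Variables (F : finFieldType) (d : nat) (t : F).
Hypotheses (oddF : odd #|F|) (nzt : t != 0).
Local Notation V := 'rV[F]_d.

(** Stated over the integers, because the characters take values in [algC] whereas the final
    estimate lives in an arbitrary real field. The Fourier transform of the kernel splits over the
    coordinates into d Gauss sums with completed squares. *)
Lemma dist_discrepancy (B : {set V}) :
  \sum_x ((#|F| * #|[set y in B | sqnorm (x - y) == t]|)%:Z - #|B|%:Z) ^+ 2
    <= 4 * #|F|%:Z ^+ d.+1 * #|B|%:Z.
Proof.
have nz2 := odd_card_neq0 oddF.
have [psi psiP] := addchar_exists F.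
pose k (z : V) : algC := \sum_(s | s != 0) psi ((sqnorm z - t) * s).
have k_fourier m : fourier psi k m =
    \sum_(s | s != 0) psi (- (t * s) - sqnorm m / (s *+ 4)) * gauss psi s ^+ d.
  rewrite /fourier /k; under eq_bigr do rewrite mulr_suml.
  rewrite exchange_big /=; apply: eq_bigr => s nzs.
  rewrite (eq_bigr (fun z : V => psi (- (t * s)) * \prod_i psi (s * z 0 i ^+ 2 + m 0 i * z 0 i))).
    rewrite -mulr_sumr (sum_row_prod (fun i a => psi (s * a ^+ 2 + m 0 i * a))).
    under eq_bigr do rewrite gauss_complete_square //.
    rewrite big_split prodr_const card_ord /= -addchar_sum // mulrA -addcharD //.
    by congr (psi (_ + _) * _); rewrite sumrN /sqnorm mulr_suml.
  move=> z _; rewrite -addchar_sum // -!addcharD //; congr psi.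
  by rewrite big_split /= -mulr_sumr /sqnorm /dotprod; ring.
have := convolution_bound (psi := psi) psiP B (k := k) (C := 4 * #|F|%:R ^+ d.+1).
have hC m : `|fourier psi k m| ^+ 2 <= 4 * #|F|%:R ^+ d.+1.
  by rewrite k_fourier twisted_gauss_sum_bound.
move=> /(_ hC).
have fE x : \sum_(y in B) k (x - y) =
    ((#|F| * #|[set y in B | sqnorm (x - y) == t]|)%:Z - #|B|%:Z)%:~R.
  rewrite (sum_addchar_count B (fun y => sqnorm (x - y) - t)) //.
  by under eq_finset do rewrite subr_eq0.
under eq_bigr do rewrite fE -intr_norm -rmorphXn /= real_normK ?num_real //.
by rewrite -(ler_int algC) rmorph_sum !rmorphM rmorphXn.
Qed.
End DistanceGraph.

Section ProductGraph.
Variables (F : finFieldType) (d : nat) (t : F).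
Hypothesis nzt : t != 0.
Local Notation V := 'rV[F]_d.

Lemma dotprodZr (a : F) (x y : V) : dotprod x (a *: y) = a * dotprod x y.
Proof. by rewrite /dotprod mulr_sumr; apply: eq_bigr => i _; rewrite mxE mulrCA. Qed.

(* After expanding the square, only the pairs (y, lambda y) with lambda y in B contribute,
   and those with lambda <> 1 contribute negatively. *)
Lemma prod_second_moment (psi : F -> algC) (B : {set V}) : addchar psi ->
  \sum_x `|\sum_(y in B) \sum_(s | s != 0) psi ((dotprod x y - t) * s)| ^+ 2
    <= #|F|%:R ^+ d.+1 * #|B|%:R.
Proof.
move=> psiP.
(* Since s (x . y) = x . (s y), the discrepancy is the Fourier transform of a function carried by
   the multiples of points of [B]. *)
pose g (z : V) := \sum_(y in B) \sum_(s | (s != 0) && (s *: y == z)) psi (- (t * s)).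
have fE x : \sum_(y in B) \sum_(s | s != 0) psi ((dotprod x y - t) * s) = fourier psi g x.
  rewrite /fourier; under [RHS]eq_bigr do rewrite mulr_suml.
  rewrite [RHS]exchange_big; apply: eq_bigr => y _.
  rewrite (partition_big (fun s => s *: y) predT) //=; apply: eq_bigr => z _.
  rewrite mulr_suml; apply: eq_bigr => s /andP[_ /eqP <-].
  by rewrite -addcharD // dotprodZr; congr psi; ring.
under eq_bigr do rewrite fE.
rewrite parseval // exprSr -mulrA; apply: ler_wpM2l; first by rewrite exprn_ge0 ?ler0n.
(* Here a = s' / s compares two representations s y = s' y' of one point, so that y' = a^-1 y. *)
have -> : \sum_z `|g z| ^+ 2 =
    \sum_(y in B) \sum_(a | (a != 0) && (a^-1 *: y \in B)) \sum_(s | s != 0) psi ((t * (a - 1)) * s).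
  rewrite (eq_bigr (fun z => \sum_(y in B) \sum_(s | (s != 0) && (s *: y == z))
    (psi (- (t * s)) * (g (s *: y))^*))); last first.
    move=> z _; rewrite normCK {1}/g mulr_suml; apply: eq_bigr => y _.
    by rewrite mulr_suml; apply: eq_bigr => s /andP[_ /eqP ->].
  rewrite exchange_big; apply: eq_bigr => y yB /=.
  rewrite [RHS](eq_bigr (fun a => \sum_(s | s != 0) psi (- (t * s)) * psi (t * (a * s)))); last first.
    by move=> a _; apply: eq_bigr => s _; rewrite -addcharD //; congr psi; ring.
  rewrite [RHS](exchange_big_dep (fun s => s != 0)) /=; last by move=> a s _.
  rewrite -(partition_big (fun s => s *: y) predT) //=.
  apply: eq_bigr => s nzs; rewrite -mulr_sumr; congr (_ * _).
  rewrite /g rmorph_sum.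
  under eq_bigr do rewrite rmorph_sum.
  rewrite (exchange_big_dep (fun s' => s' != 0)) /=; last by move=> y' s' _ /andP[].
  have invs : s^-1 != 0 by rewrite invr_eq0.
  rewrite [RHS](reindex_inj (mulIf invs)) /=.
  rewrite [RHS](eq_bigl (fun a => (a != 0) && ((a / s)^-1 *: y \in B))); last first.
    by move=> a; rewrite /= ?nzs mulf_eq0 (negPf invs) orbF ?andbT.
  rewrite [RHS]big_mkcondr /=; apply: eq_bigr => a nza.
  have -> : \sum_(y' in B | (a != 0) && (a *: y' == s *: y)) (psi (- (t * a)))^* =
      \sum_(y' in B | y' == (a / s)^-1 *: y) psi (t * a).
    apply: eq_big => [y'|y' _]; last by rewrite conj_addchar // opprK.
    congr (_ && _); rewrite nza /= invf_div.
    by rewrite -[RHS](inj_eq (scalerI nza)) scalerA mulrC divfK.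
  rewrite big_mkcondl /= big_pred1_eq -/(_ \in B).
  by case: ifP => // _; congr psi; rewrite divfK.
apply: (@le_trans _ _ (\sum_(y in B) #|F|%:R)); last by rewrite sumr_const mulr_natr.
apply: ler_sum => y yB.
rewrite (eq_bigr (fun a => #|F|%:R *+ (a == 1) - 1)) => [|a _]; last first.
  by rewrite sum_addcharM_neq0 // mulf_eq0 (negPf nzt) subr_eq0.
rewrite (bigD1 1) ?oner_neq0 ?invr1 ?scale1r ?eqxx //=.
apply: (@le_trans _ _ ((#|F|%:R - 1) + 0)).
  apply: lerD => //; apply: sumr_le0 => a /andP[_ /negPf ->].
  by rewrite mulr0n sub0r oppr_le0 ler01.
by rewrite addr0 lerBlDr lerDl ler01.
Qed.

Lemma prod_discrepancy (B : {set V}) :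
  \sum_x ((#|F| * #|[set y in B | dotprod x y == t]|)%:Z - #|B|%:Z) ^+ 2
    <= 4 * #|F|%:Z ^+ d.+1 * #|B|%:Z.
Proof.
have [psi psiP] := addchar_exists F.
have := prod_second_moment B psiP.
have fE x : \sum_(y in B) \sum_(s | s != 0) psi ((dotprod x y - t) * s) =
    ((#|F| * #|[set y in B | dotprod x y == t]|)%:Z - #|B|%:Z)%:~R.
  rewrite (sum_addchar_count B (fun y => dotprod x y - t)) //.
  by under eq_finset do rewrite subr_eq0.
under eq_bigr do rewrite fE -intr_norm -rmorphXn /= real_normK ?num_real //.
move=> le1; apply: (@le_trans _ _ (#|F|%:Z ^+ d.+1 * #|B|%:Z)).
  by rewrite -(ler_int algC) rmorph_sum !rmorphM rmorphXn.
by rewrite -mulrA ler_peMl // mulr_ge0 // exprn_ge0.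
Qed.

End ProductGraph.

(** * Embeddings of trees *)

Section TreeGrowth.
Variables (T : finType) (eT : rel T).
Hypothesis hT : is_tree eT.

Let symT : symmetric eT. Proof. by case: hT. Qed.
Let irrT : irreflexive eT. Proof. by case: hT. Qed.

Definition induced (A : {set T}) : rel T := [rel x y | [&& eT x y, x \in A & y \in A]].

Definition connected_in (A : {set T}) := {in A &, forall u v, connect (induced A) u v}.

Let induced_sym A : symmetric (induced A).
Proof. by move=> x y; rewrite /induced /= symT; congr (_ && _); rewrite andbC. Qed.

Lemma connected_inT : connected_in [set: T].
Proof.
move=> u v _ _; rewrite (eq_connect (e' := eT)); first by case: hT.
by move=> x y; rewrite /induced /= !inE !andbT.
Qed.

Lemma connected_in1 r : connected_in [set r].
Proof. by move=> u v; rewrite !inE => /eqP -> /eqP ->. Qed.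

Lemma frontier_edge (A B : {set T}) r : connected_in A -> B \proper A -> r \in B ->
  exists p v, [/\ p \in B, v \in A, v \notin B & eT p v].
Proof.
move=> cA /properP[/subsetP BA [c cA' ncB]] rB.
have /connectP[w] := cA r c (BA _ rB) cA'.
elim: w r rB => [|y w IH] r rB /=; first by move=> _ e; rewrite e rB in ncB.
case/andP => /and3P[ery rA yA] pw lw.
have [yB|nyB] := boolP (y \in B); first exact: IH yB pw lw.
by exists r, y; split.
Qed.

Lemma connected_inU1 A p v : connected_in A -> p \in A -> eT p v -> connected_in (v |: A).
Proof.
move=> cA pA epv.
have sub : subrel (connect (induced A)) (connect (induced (v |: A))).
  apply: connect_sub => x y /and3P[exy xA yA]; apply: connect1.
  by rewrite /induced /= exy !inE xA yA !orbT.
have cs : connect_sym (induced (v |: A)) by apply/sym_connect_sym/induced_sym.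
have toP u : u \in v |: A -> connect (induced (v |: A)) p u.
  rewrite !inE => /orP[/eqP ->|uA]; last exact/sub/cA.
  by apply: connect1; rewrite /induced /= epv !inE eqxx pA orbT.
by move=> u u' uA uA'; apply: connect_trans (toP _ uA'); rewrite cs toP.
Qed.

(** A simple path inside [A] between two distinct neighbours of v would close up through v to a
    cycle of length at least 3. *)
Lemma unique_neighbour A p p' v : connected_in A -> p \in A -> p' \in A -> v \notin A ->
  eT p v -> eT p' v -> p = p'.
Proof.
move=> cA pA p'A vA epv ep'v; have [//|ne] := eqVneq p p'.
have /connectP[w0 pw0 lw0] := cA p p' pA p'A.
case/shortenP: pw0 lw0 => w pw uw _ lw.
have wA : all (mem A) w.
  elim: w (p) pw {uw lw} => //= y w IH x /andP[/and3P[_ _ yA] pw].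
  by rewrite yA (IH _ pw).
have pwT : path eT p w by apply: sub_path pw => x y /and3P[].
have [_ _ _ acyc] := hT.
have : (size [:: v, p & w] <= 2)%N.
  apply: acyc; apply/andP; split.
    by rewrite /= rcons_path pwT -lw ep'v symT epv.
  rewrite /= in uw *; rewrite uw andbT inE negb_or; apply/andP; split.
    by apply: contraNneq vA => ->.
  by apply: contra vA => vw; apply: (allP wA).
by case: w lw {uw pw pwT wA} => [/= e|//]; rewrite e eqxx in ne.
Qed.

Section Counting.
Variables (R : realFieldType) (V : finType) (e : rel V) (E : {set V}).
Hypotheses (e_sym : symmetric e) (V_gt0 : (0 < #|V|)%N).
Local Notation n := (#|V|%:R : R).
Local Notation deg x := #|[set y in E | e x y]|.

Definition good (A : {set T}) (s : {ffun T -> V}) : bool :=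
  [forall u in A, s u \in E] && [forall u in A, forall v in A, eT u v ==> e (s u) (s v)].

Lemma goodP (A : {set T}) (s : {ffun T -> V}) : reflect ((forall u, u \in A -> s u \in E) /\
  (forall u v, u \in A -> v \in A -> eT u v -> e (s u) (s v))) (good A s).
Proof.
apply: (iffP andP) => -[h1 h2]; split.
- by move=> u uA; move/forallP/(_ u)/implyP: h1; apply.
- by move=> u v uA vA euv; move/forall_inP/(_ u uA)/forall_inP/(_ v vA)/implyP: h2; apply.
- by apply/forall_inP.
- by apply/forall_inP => u uA; apply/forall_inP => v vA; apply/implyP; apply: h2.
Qed.

Definition upd (s : {ffun T -> V}) v x : {ffun T -> V} := [ffun w => if w == v then x else s w].

(** Exchanging x with the value of s at v is an involution on the pairs (s, x). *)
Lemma sum_upd (f : {ffun T -> V} -> R) v : \sum_s \sum_x f (upd s v x) = n * \sum_s f s.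
Proof.
rewrite pair_bigA /= mulr_sumr.
have hK : involutive (fun p : {ffun T -> V} * V => (upd p.1 v p.2, p.1 v)).
  move=> [s x] /=; congr (_, _); last by rewrite ffunE eqxx.
  by apply/ffunP => w; rewrite !ffunE; case: eqP => [->|].
rewrite (reindex_inj (inv_inj hK)) /=.
rewrite (eq_bigr (fun p : {ffun T -> V} * V => f p.1)); last first.
  by move=> p _; congr f; exact: (congr1 fst (hK p)).
rewrite -(pair_bigA _ (fun s _ => f s)) /=; apply: eq_bigr => s _.
by rewrite sumr_const mulr_natl.
Qed.

Lemma good_upd (A : {set T}) (s : {ffun T -> V}) v x : v \notin A -> good (v |: A) (upd s v x) -> good A s && (x \in E).
Proof.
move=> vA /goodP[h1 h2].
have updA u : u \in A -> upd s v x u = s u.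
  by move=> uA; rewrite ffunE; case: eqP uA vA => // -> ->.
apply/andP; split; last by have := h1 v (setU11 _ _); rewrite ffunE eqxx.
apply/goodP; split=> [u uA|u w uA wA euw].
  by rewrite -(updA u uA) h1 // inE uA orbT.
by rewrite -(updA u uA) -(updA w wA) h2 // inE ?uA ?wA orbT.
Qed.

Lemma good_upd_edge (A : {set T}) (s : {ffun T -> V}) v x p : v \notin A -> p \in A -> eT p v ->
  good (v |: A) (upd s v x) -> [&& good A s, x \in E & e (s p) x].
Proof.
move=> vA pA epv g; have /andP[-> ->] := good_upd vA g; case/goodP: g => _ h2.
have := h2 p v; rewrite !inE eqxx pA orbT => /(_ isT isT epv).
rewrite !ffunE eqxx; case: eqP => // pv; by rewrite -pv pA in vA.
Qed.

(** The converse of [good_upd_edge] rests on acyclicity: p is the only neighbour of v in [A], so a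
    single edge has to be checked. *)
Lemma good_upd_edgeE (A : {set T}) (s : {ffun T -> V}) v x p : connected_in A -> v \notin A -> p \in A -> eT p v ->
  good (v |: A) (upd s v x) = [&& good A s, x \in E & e (s p) x].
Proof.
move=> cA vA pA epv; apply/idP/and3P => [g|[/goodP[h1 h2] xE ex]].
  exact/and3P/(good_upd_edge vA pA epv g).
have updA u : u \in A -> upd s v x u = s u.
  by move=> uA; rewrite ffunE; case: eqP uA vA => // -> ->.
have updv : upd s v x v = x by rewrite ffunE eqxx.
apply/goodP; split=> [u|u w].
  by rewrite !inE => /orP[/eqP ->|uA]; rewrite ?updv ?updA ?h1.
rewrite !inE => /orP[/eqP ->|uA] /orP[/eqP ->|wA] euw.
- by rewrite irrT in euw.
- rewrite updv updA // e_sym; rewrite symT in euw.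
  by rewrite -(unique_neighbour cA pA wA vA epv euw).
- by rewrite updv updA // -(unique_neighbour cA pA uA vA epv euw).
- by rewrite !updA // h2.
Qed.

(* [avg_count A f] is the sum of [f] over the good maps on [A]; a map is represented by
   all its extensions to [T], which are averaged out. *)
Definition avg_count (A : {set T}) (f : {ffun T -> V} -> R) : R :=
  (\sum_(s | good A s) f s) / n ^+ (#|T| - #|A|).

Let n_gt0 : 0 < n. Proof. by rewrite ltr0n. Qed.
Let n_neq0 : n != 0. Proof. by rewrite gt_eqF. Qed.

Lemma avg_countU1 (A : {set T}) v f : v \notin A ->
  avg_count (v |: A) f =
  (\sum_s \sum_(x | good (v |: A) (upd s v x)) f (upd s v x)) / n ^+ (#|T| - #|A|).
Proof.
move=> vA; have cA : (#|T| - #|A| = (#|T| - #|v |: A|).+1)%N.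
  have := max_card (mem (v |: A)); rewrite cardsU1 vA; lia.
under [in RHS]eq_bigr do rewrite big_mkcond /=.
rewrite (sum_upd (fun s => if good (v |: A) s then f s else 0)) -big_mkcond /=.
by rewrite /avg_count cA exprS invfM mulrACA divff // mul1r.
Qed.

Lemma sum_good_deg (A : {set T}) p (f : {ffun T -> V} -> R) :
  \sum_s \sum_(x | [&& good A s, x \in E & e (s p) x]) f s =
  \sum_(s | good A s) f s * (deg (s p))%:R.
Proof.
rewrite [RHS]big_mkcond; apply: eq_bigr => s _.
case: (good A s); last by rewrite big_pred0.
by rewrite sumr_const mulr_natr cardsE.
Qed.

Lemma avg_countU1_edge (A : {set T}) p v : connected_in A -> p \in A -> v \notin A -> eT p v ->
  avg_count (v |: A) (fun=> 1) = avg_count A (fun s => (deg (s p))%:R).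
Proof.
move=> cA pA vA epv; rewrite avg_countU1 //; congr (_ / _).
rewrite (eq_bigr (fun s => \sum_(x | [&& good A s, x \in E & e (s p) x]) 1)).
  by rewrite (sum_good_deg A p (fun=> 1)); apply: eq_bigr => s _; rewrite mul1r.
by move=> s _; apply: eq_bigl => x; apply: good_upd_edgeE.
Qed.

Lemma avg_count1 r (h : V -> R) : avg_count [set r] (fun s => h (s r)) = \sum_(x in E) h x.
Proof.
have good1 s : good [set r] s = (s r \in E).
  apply/goodP/idP => [[h1 _]|rE]; first by rewrite h1 // inE.
  by split=> [u|u v]; rewrite !inE => /eqP -> // /eqP ->; rewrite irrT.
rewrite /avg_count; apply: (mulfI n_neq0); rewrite mulrA [X in n * X]big_mkcond /=.
rewrite -(sum_upd _ r) (eq_bigr (fun=> \sum_(x in E) h x)) => [|s _]; last first.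
  by rewrite [RHS]big_mkcond; apply: eq_bigr => x _; rewrite good1 ffunE eqxx.
rewrite sumr_const card_ffun cards1 -[_ *+ (_ ^ _)]mulr_natl natrX subn1.
have T_gt0 : (0 < #|T|)%N by apply/card_gt0P; exists r.
rewrite -[in n ^+ #|T|](prednK T_gt0) exprS -!mulrA; congr (_ * _).
by rewrite mulrCA divff ?mulr1 // expf_neq0.
Qed.

Variable Delta : R.
Hypotheses (Delta_ge0 : 0 <= Delta) (degE : forall x, x \in E -> (deg x)%:R <= Delta).

(** Only the edge from p to v is kept, which leaves at most [Delta] choices for the new vertex. *)
Lemma avg_count_le_edge (A : {set T}) p v r (h : V -> R) : p \in A -> v \notin A -> eT p v ->
  r \in A -> (forall x, 0 <= h x) ->
  avg_count (v |: A) (fun s => h (s r)) <= Delta * avg_count A (fun s => h (s r)).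
Proof.
move=> pA vA epv rA h0; rewrite avg_countU1 // /avg_count mulrA.
rewrite ler_wpM2r ?invr_ge0 ?exprn_ge0 ?ler0n //.
apply: (@le_trans _ _ (\sum_s \sum_(x | [&& good A s, x \in E & e (s p) x]) h (s r))).
  apply: ler_sum => s _; rewrite [leLHS]big_mkcond [leRHS]big_mkcond; apply: ler_sum => x _.
  have -> : upd s v x r = s r by rewrite ffunE; case: eqP => // rv; rewrite -rv rA in vA.
  case: ifP => [/(good_upd_edge vA pA epv) -> //|_].
  by case: ifP.
rewrite (sum_good_deg A p (fun s => h (s r))) mulr_sumr; apply: ler_sum => s /goodP[h1 _].
by rewrite mulrC ler_wpM2r // degE // h1.
Qed.

(** Growing [A] from r itself puts the weight [h] on the first vertex; every later vertex costs a
    factor [Delta]. *)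
Lemma avg_count_le (A : {set T}) r (h : V -> R) : connected_in A -> r \in A ->
  (forall x, 0 <= h x) ->
  avg_count A (fun s => h (s r)) <= Delta ^+ #|A|.-1 * \sum_(x in E) h x.
Proof.
move=> cA rA h0.
have grow i : (i < #|A|)%N -> exists B : {set T}, [/\ B \subset A, r \in B, #|B| = i.+1
    & avg_count B (fun s => h (s r)) <= Delta ^+ i * \sum_(x in E) h x].
  elim: i => [|i IH] iA.
    exists [set r]; rewrite sub1set rA inE eqxx cards1 expr0 mul1r avg_count1.
    by split.
  have [B [BA rB cB leB]] := IH (ltnW iA).
  have pB : B \proper A by rewrite properEcard BA cB.
  have [p [v [pB' vA vB epv]]] := frontier_edge cA pB rB.
  exists (v |: B); split.
  - by rewrite subUset sub1set vA.
  - by rewrite inE rB orbT.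
  - by rewrite cardsU1 vB cB.
  - apply: le_trans (avg_count_le_edge pB' vB epv rB h0) _.
    by rewrite exprS -mulrA ler_wpM2l.
have A_gt0 : (0 < #|A|)%N by apply/card_gt0P; exists r.
have [B [BA rB cB leB]] := grow #|A|.-1 (eq_leq (prednK A_gt0)).
have eBA : B = A by apply/eqP; rewrite eqEcard BA cB prednK ?leqnn.
by move: leB; rewrite eBA.
Qed.

(** A telescoping sum: adding the leaf number j + 1 replaces a degree by a, at a cost of the total
    deviation times [Delta ^+ j], and each leaf added later multiplies that error by a. *)
Lemma avg_count_tree (a : R) (r : nat) : 0 <= a -> #|T| = r.+1 ->
  `|avg_count [set: T] (fun=> 1) - #|E|%:R * a ^+ r| <=
    (\sum_(x in E) `|(deg x)%:R - a|) * \sum_(j < r) a ^+ (r.-1 - j) * Delta ^+ j.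
Proof.
move=> a0 cT; pose S := \sum_(x in E) `|(deg x)%:R - a|.
have [r0 _] : exists r0 : T, r0 \in T by apply/card_gt0P; rewrite cT.
have grow i : (i <= r)%N -> exists A : {set T}, [/\ connected_in A, #|A| = i.+1
    & `|avg_count A (fun=> 1) - #|E|%:R * a ^+ i| <= S * \sum_(j < i) a ^+ (i.-1 - j) * Delta ^+ j].
  elim: i => [|i IH] ir.
    exists [set r0]; rewrite cards1 big_ord0 mulr0 expr0 mulr1; split=> //.
      exact: connected_in1.
    by rewrite (avg_count1 r0 (fun=> 1)) sumr_const subrr normr0.
  have [A [cA sA leA]] := IH (ltnW ir).
  have [p0 p0A] : exists p0, p0 \in A by apply/card_gt0P; rewrite sA.
  have pA : A \proper [set: T] by rewrite properEcard subsetT sA cardsT cT ltnS.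
  have [p [v [pA' _ vA epv]]] := frontier_edge connected_inT pA p0A.
  exists (v |: A); split; first exact: connected_inU1 epv.
    by rewrite cardsU1 vA sA.
  rewrite (avg_countU1_edge cA pA' vA epv).
  have step : `|avg_count A (fun s => (deg (s p))%:R) - a * avg_count A (fun=> 1)| <= S * Delta ^+ i.
    have -> : avg_count A (fun s => (deg (s p))%:R) - a * avg_count A (fun=> 1) =
        avg_count A (fun s => (deg (s p))%:R - a).
      rewrite /avg_count mulrA -mulrBl; congr (_ / _).
      by rewrite mulr_sumr -sumrB; apply: eq_bigr => s _; rewrite mulr1.
    apply: (@le_trans _ _ (avg_count A (fun s => `|(deg (s p))%:R - a|))).
      rewrite /avg_count normrM [X in _ * X]ger0_norm ?invr_ge0 ?exprn_ge0 ?ler0n //.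
      by rewrite ler_wpM2r ?invr_ge0 ?exprn_ge0 ?ler0n // ler_norm_sum.
    have := avg_count_le (h := fun x => `|(deg x)%:R - a|) cA pA' (fun=> normr_ge0 _).
    by rewrite sA mulrC.
  have -> : avg_count A (fun s => (deg (s p))%:R) - #|E|%:R * a ^+ i.+1 =
      (avg_count A (fun s => (deg (s p))%:R) - a * avg_count A (fun=> 1)) +
      a * (avg_count A (fun=> 1) - #|E|%:R * a ^+ i) by rewrite exprS; ring.
  apply: le_trans (ler_normD _ _) _.
  rewrite big_ord_recr /= subnn expr0 mul1r [S * _]mulrDr [leRHS]addrC lerD //.
  rewrite normrM (ger0_norm a0); apply: le_trans (ler_wpM2l a0 leA) _.
  rewrite mulrCA ler_wpM2l ?sumr_ge0 // mulr_sumr; apply: ler_sum => j _.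
  have i_gt0 : (0 < i)%N by apply: leq_ltn_trans (ltn_ord j).
  rewrite mulrA -exprS -subSn ?prednK //.
  by rewrite -ltnS prednK.
have [A [_ sA leA]] := grow r (leqnn r).
suff <- : A = [set: T] by [].
by apply/eqP; rewrite eqEcard subsetT cardsT cT sA leqnn.
Qed.

Lemma avg_count_tree_le (r : nat) : #|T| = r.+1 ->
  avg_count [set: T] (fun=> 1) <= #|E|%:R * Delta ^+ r.
Proof.
move=> cT; have [r0 _] : exists r0 : T, r0 \in T by apply/card_gt0P; rewrite cT.
have := avg_count_le (h := fun=> 1) connected_inT (in_setT r0) (fun=> ler01).
by rewrite cardsT cT /= sumr_const mulrC.
Qed.

Lemma avg_count_embeddings :
  avg_count [set: T] (fun=> 1) =
  (num_embeddings eT (fun x y : {x | x \in E} => e (val x) (val y)))%:R.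
Proof.
rewrite /avg_count cardsT subnn expr0 divr1 sumr_const; congr _%:R.
pose vals (s : {ffun T -> {x | x \in E}}) : {ffun T -> V} := [ffun u => val (s u)].
have valsI : injective vals.
  by move=> s s' /ffunP h; apply/ffunP => u; apply: val_inj; have := h u; rewrite !ffunE.
rewrite /num_embeddings -(card_imset _ valsI); apply: eq_card => s.
apply/goodP/imsetP => [[h1 h2]|[s' ]].
  exists [ffun u => exist _ (s u) (h1 u (in_setT u))].
    rewrite inE; apply/forallP => u; apply/forallP => v; apply/implyP => euv.
    by rewrite !ffunE /=; apply: h2; rewrite ?inE.
  by apply/ffunP => u; rewrite !ffunE.
rewrite inE => /forallP h ->; split=> [u _|u v _ _ euv]; rewrite !ffunE; first exact: valP.
by have /forallP/(_ v)/implyP := h u; apply.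
Qed.

End Counting.
End TreeGrowth.

(** * Numerical inequalities *)

Section NumericBounds.
Variable R : realType.
Implicit Types lam sig mu theta A x : R.

Lemma bernoulli_ineq mu n : 0 <= mu <= 1 -> 1 - n%:R * mu <= (1 - mu) ^+ n.
Proof.
move=> /andP[m0 m1]; elim: n => [|n IH]; first by rewrite expr0 mul0r subr0.
have h : (1 - mu) * (1 - n%:R * mu) <= (1 - mu) ^+ n.+1.
  by rewrite exprS ler_wpM2l // subr_ge0.
apply: le_trans h; have : 0 <= n%:R * mu ^+ 2 by rewrite mulr_ge0 ?ler0n ?sqr_ge0.
by rewrite -natr1; nra.
Qed.

Lemma convex_power theta A n : 0 <= theta <= 1 -> 1 <= A ->
  (1 - theta + theta * A) ^+ n <= 1 - theta + theta * A ^+ n.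
Proof.
move=> /andP[t0 t1] A1; elim: n => [|n IH]; first by rewrite !expr0 mulr1 subrK.
have An : 1 <= A ^+ n by rewrite exprn_ege1.
have pos : 0 <= 1 - theta + theta * A by rewrite addr_ge0 ?subr_ge0 // mulr_ge0 // (le_trans ler01).
rewrite exprS; apply: le_trans (ler_wpM2l pos IH) _.
have : 0 <= theta * (1 - theta) * ((A - 1) * (A ^+ n - 1)).
  by rewrite !mulr_ge0 ?subr_ge0.
by rewrite exprS; move: (A ^+ n) => B; nra.
Qed.

Lemma power_le_expR x r : 0 <= x -> (1 + x / r.+1%:R) ^+ r.+1 <= expR x.
Proof.
move=> x0; have -> : expR x = expR (x / r.+1%:R) ^+ r.+1.
  by rewrite -expRM_natr divfK // pnatr_eq0.
by rewrite lerXn2r ?nnegrE ?expR_ge0 ?expR_ge1Dx // addr_ge0 // divr_ge0.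
Qed.

Lemma expR_le_inv x m : 0 <= x -> x < m.+1%:R -> expR x <= (1 - x / m.+1%:R) ^- m.+1.
Proof.
move=> x0 xm; have m0 : 0 < m.+1%:R :> R by rewrite ltr0n.
have pos : 0 < 1 - x / m.+1%:R by rewrite subr_gt0 ltr_pdivrMr // mul1r.
rewrite -[expR x]invrK -expRN lef_pV2 ?posrE ?expR_gt0 ?exprn_gt0 //.
have -> : expR (- x) = expR (- x / m.+1%:R) ^+ m.+1.
  by rewrite -expRM_natr divfK // gt_eqF.
rewrite lerXn2r ?nnegrE ?expR_ge0 ?(ltW pos) //.
by apply: le_trans (expR_ge1Dx _); rewrite mulNr.
Qed.

(** By convexity the power lies below its chord over 0 <= lam <= 1/2. At the right end it is at most
    exp (3/2) <= 5, so the slope is at most (5 - 1) / (1/2) = 8. *)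
Lemma upper_factor lam r : 0 <= lam <= 1 / 2 -> (1 + 3 * lam / r.+1%:R) ^+ r.+1 <= 1 + 8 * lam.
Proof.
move=> /andP[l0 l1]; pose theta := 2 * lam; pose A := 1 + (3 / 2) / r.+1%:R : R.
have -> : 1 + 3 * lam / r.+1%:R = 1 - theta + theta * A.
  have : (r.+1%:R : R) != 0 by rewrite pnatr_eq0.
  by rewrite /theta /A; move: (r.+1%:R) => m m0; field.
have A1 : 1 <= A by rewrite lerDl divr_ge0 ?ler0n //; lra.
apply: le_trans (convex_power _ _ A1) _; first by rewrite /theta; apply/andP; split; lra.
have A5 : A ^+ r.+1 <= 5.
  apply: le_trans (power_le_expR r _) _; first lra.
  apply: le_trans (expR_le_inv (m := 15) _ _) _; [lra | lra |].
  rewrite -[leRHS]invrK lef_pV2 ?posrE; lra.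
by rewrite /theta; nra.
Qed.

Lemma upper_factor_small lam r : 0 <= lam <= 1 / 8 -> (1 + 3 * lam / r.+1%:R) ^+ r.+1 <= 8 / 5.
Proof.
move=> /andP[l0 l1]; apply: le_trans (power_le_expR r _) _; first lra.
apply: (@le_trans _ _ (expR (3 / 8))); first by rewrite ler_expR; lra.
apply: le_trans (expR_le_inv (m := 0) _ _) _; [lra | lra |].
by rewrite expr1 divr1 -[leRHS]invrK lef_pV2 ?posrE; lra.
Qed.

(** With r = k + 2 this comes down to 2 r^2 <= 9 * 2^k, an equality at r = 3. The 9 is the square of
    the 3 in [delta]. *)
Lemma removed_fraction lam k : 0 <= lam <= 1 / 2 ->
  4 * k.+2%:R ^+ 2 / 9 * lam ^+ k.+1 <= 2 * lam.
Proof.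
move=> /andP[l0 l1].
have nat_le : (2 * k.+2 ^ 2 <= 9 * 2 ^ k)%N.
  case: k => [|k] //; elim: k => [|k IH] //.
  by move: IH; rewrite !expnS !expn0; move: (2 ^ k)%N => p; nia.
have lk : lam ^+ k * 2 ^+ k <= 1.
  by rewrite -exprMn exprn_ile1 ?mulr_ge0 //; lra.
have lk0 : 0 <= lam ^+ k by apply: exprn_ge0.
have : 2 * k.+2%:R ^+ 2 <= 9 * 2 ^+ k :> R by rewrite -!natrX -!natrM ler_nat.
rewrite [lam ^+ k.+1]exprS; move: (lam ^+ k) (2 ^+ k : R) (k.+2%:R ^+ 2 : R) lk lk0 => L P Q h1 h2 h3.
have : 2 * Q * L <= 9 by have /= := ler_wpM2r h2 h3; nra.
by nra.
Qed.

(** The first term is the loss due to removed vertices, the second the telescoped error of the tree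
    count. They are at most 16/3 and 2.304 times sig^2. *)
Lemma lower_error sig k : 0 <= sig -> sig ^+ 2 <= 1 / 8 ->
  k.+3%:R * (4 * k.+2%:R ^+ 2 / 9 * (sig ^+ 2) ^+ k.+1) + 2 * k.+2%:R * sig ^+ k.+3 * (8 / 5)
    <= 8 * sig ^+ 2.
Proof.
move=> s0 s2.
have s36 : sig <= 36 / 100 by nra.
have b1 : k.+3%:R * k.+2%:R ^+ 2 * (sig ^+ 2) ^+ k <= 12.
  have nat_le : (k.+3 * k.+2 ^ 2 <= 12 * 8 ^ k)%N.
    elim: k => [|k IH] //.
    by move: IH; rewrite !expnS !expn0; move: (8 ^ k)%N => p; nia.
  have : k.+3%:R * k.+2%:R ^+ 2 <= 12 * 8 ^+ k :> R by rewrite -!natrX -!natrM ler_nat.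
  have lk : (sig ^+ 2) ^+ k * 8 ^+ k <= 1.
    by rewrite -exprMn exprn_ile1 ?mulr_ge0 ?sqr_ge0 //; lra.
  have lk0 : 0 <= (sig ^+ 2) ^+ k by rewrite exprn_ge0 ?sqr_ge0.
  move: ((sig ^+ 2) ^+ k) (8 ^+ k : R) (k.+3%:R * k.+2%:R ^+ 2 : R) lk lk0 => L P Q h1 h2 h3.
  by have /= := ler_wpM2r h2 h3; nra.
have b2 : k.+2%:R * sig ^+ k.+1 <= 72 / 100.
  elim: (k) => [|j IH]; first by rewrite expr1; lra.
  rewrite [sig ^+ _]exprS -[j.+3%:R]natr1.
  have j2 : 2 <= j.+2%:R :> R by rewrite ler_nat.
  have sj : 0 <= sig ^+ j.+1 by apply: exprn_ge0.
  move: (sig ^+ j.+1) (j.+2%:R : R) IH j2 sj => L m h1 h2 h3.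
  have : (m + 1) * sig <= m by nra.
  by nra.
have -> : (sig ^+ 2) ^+ k.+1 = sig ^+ 2 * (sig ^+ 2) ^+ k by rewrite exprS.
have -> : sig ^+ k.+3 = sig ^+ 2 * sig ^+ k.+1 by rewrite -exprD.
have := sqr_ge0 sig.
move: (sig ^+ 2) (sig ^+ k.+1) b1 b2 => L M.
move: (L ^+ k) (k.+2%:R : R) (k.+3%:R : R) => Lk m2 m3 b1 b2 L0.
by nra.
Qed.

End NumericBounds.

(** * Counting embeddings under a discrepancy bound *)

Lemma sqr_sum_le (R : realFieldType) (I : finType) (P : pred I) (f : I -> R) :
  (\sum_(i | P i) f i) ^+ 2 <= #|P|%:R * \sum_(i | P i) f i ^+ 2.
Proof.
have : 0 <= \sum_(i | P i) \sum_(j | P j) (f i - f j) ^+ 2.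
  by apply: sumr_ge0 => i _; apply: sumr_ge0 => j _; apply: sqr_ge0.
have -> : \sum_(i | P i) \sum_(j | P j) (f i - f j) ^+ 2 =
    2 * (#|P|%:R * \sum_(i | P i) f i ^+ 2) - 2 * (\sum_(i | P i) f i) ^+ 2.
  rewrite [in RHS]expr2 big_distrlr /=.
  rewrite (eq_bigr (fun i => #|P|%:R * f i ^+ 2 + \sum_(j | P j) f j ^+ 2 -
      2 * \sum_(j | P j) f i * f j)) => [|i _]; last first.
    rewrite (eq_bigr (fun j => f i ^+ 2 + f j ^+ 2 - 2 * (f i * f j))) => [|j _]; last by ring.
    by rewrite sumrB big_split /= sumr_const mulr_natl -mulr_sumr.
  by rewrite sumrB big_split /= -!mulr_sumr sumr_const -mulr_natl; ring.
by rewrite subr_ge0 ler_pM2l ?ltr0n.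
Qed.

Section EmbeddingCount.
Variables (R : realType) (T : finType) (eT : rel T) (r : nat).
Hypotheses (hT : is_tree eT) (cT : #|T| = r.+1).
Variables (V : finType) (e : rel V) (q : nat) (X : R).
Hypotheses (e_sym : symmetric e) (q_gt0 : (0 < q)%N).
Local Notation deg B x := #|[set y in B | e x y]|.

(* [X] stands for [q ^ (d + 1)]. *)
Hypothesis discrepancy : forall B : {set V},
  \sum_x (q%:R * (deg B x)%:R - #|B|%:R) ^+ 2 <= 4 * X * #|B|%:R.

Variables (E : {set V}) (sig : R).
Hypotheses (sig_gt0 : 0 < sig) (E_gt0 : (0 < #|E|)%N).
Hypothesis X_lt : X < sig ^+ (r.+1).*2 * #|E|%:R ^+ 2.

Local Notation lam := (sig ^+ 2).
Local Notation N := (#|E|%:R : R).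
Local Notation D := (N / q%:R : R).
Local Notation nT E' := ((num_embeddings eT (fun x y : {x | x \in E'} => e (val x) (val y)))%:R : R).

Let q0 : 0 < q%:R :> R. Proof. by rewrite ltr0n. Qed.
Let N0 : 0 < N. Proof. by rewrite ltr0n. Qed.
Let D0 : 0 < D. Proof. exact: divr_gt0. Qed.
Let V_gt0 : (0 < #|V|)%N. Proof. exact: leq_trans E_gt0 (max_card _). Qed.

(** Cauchy-Schwarz applied to the discrepancy bound, with X replaced through [X_lt]. *)
Let deviation (B : {set V}) : B \subset E ->
  \sum_(x in B) `|(deg B x)%:R - #|B|%:R / q%:R| <= 2 * N * D * sig ^+ r.+1.
Proof.
move=> BE; have BN : #|B|%:R <= N by rewrite ler_nat subset_leq_card.
have B0 : 0 <= #|B|%:R :> R by apply: ler0n.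
have s0 : 0 <= sig ^+ r.+1 by rewrite exprn_ge0 // ltW.
have rhs0 : 0 <= 2 * N * D * sig ^+ r.+1.
  by apply: mulr_ge0 => //; apply: mulr_ge0; [apply: mulr_ge0 => //; exact: ltW | exact: ltW].
rewrite -ler_sqr ?nnegrE ?sumr_ge0 //.
apply: le_trans (sqr_sum_le _ _) _.
have : \sum_(x in B) (q%:R * (deg B x)%:R - #|B|%:R) ^+ 2 <= 4 * X * #|B|%:R.
  apply: le_trans (discrepancy B); rewrite [leRHS](bigID (mem B)) /= lerDl.
  by apply: sumr_ge0 => x _; apply: sqr_ge0.
rewrite (eq_bigr (fun x => q%:R ^+ 2 * `|(deg B x)%:R - #|B|%:R / q%:R| ^+ 2)) => [|x _]; last first.
  by rewrite real_normK ?num_real // -exprMn mulrBr mulrCA divff ?mulr1 // gt_eqF.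
rewrite -mulr_sumr; set Q := \sum_(x in B) _ => hQ.
have {}hQ : Q <= 4 * X * #|B|%:R / q%:R ^+ 2.
  by rewrite ler_pdivlMr ?exprn_gt0 // mulrC.
apply: le_trans (ler_wpM2l B0 hQ) _.
have X0 : 0 <= X.
  have : 0 <= 4 * X * N.
    by apply: le_trans (discrepancy E); apply: sumr_ge0 => x _; apply: sqr_ge0.
  by rewrite pmulr_lge0 // pmulr_rge0 // ltr0n.
have B2 : #|B|%:R ^+ 2 <= N ^+ 2 by rewrite lerXn2r // nnegrE ltW.
have XP : X <= (sig ^+ r.+1) ^+ 2 * N ^+ 2 by rewrite -exprM muln2; exact: ltW.
move: (sig ^+ r.+1) XP => u XP.
have -> : #|B|%:R * (4 * X * #|B|%:R / q%:R ^+ 2) = 4 / q%:R ^+ 2 * (X * #|B|%:R ^+ 2).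
  by ring.
have -> : (2 * N * D * u) ^+ 2 = 4 / q%:R ^+ 2 * ((u ^+ 2 * N ^+ 2) * N ^+ 2).
  by field; rewrite gt_eqF.
rewrite ler_wpM2l ?divr_ge0 ?exprn_ge0 ?(ltW q0) //.
by rewrite ler_pM // exprn_ge0.
Qed.

Definition good_subset (E' : {set V}) : Prop :=
  [/\ E' \subset E, #|E :\: E'|%:R <= 2 * lam * N
    & `|nT E' - N ^+ r.+1 / q%:R ^+ r| <= 8 * (N ^+ r.+1 / q%:R ^+ r) * lam].

Let mainE : N ^+ r.+1 / q%:R ^+ r = N * D ^+ r.
Proof. by rewrite exprS expr_div_n mulrA. Qed.

Let M0 : 0 < N * D ^+ r. Proof. by rewrite mulr_gt0 ?exprn_gt0. Qed.

(** Both bounds are then weak enough to discard everything: 2 lam >= 1 and 8 lam >= 1. *)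
Lemma good_subset_large : 1 / 2 <= lam -> good_subset set0.
Proof.
move=> l2; split; first exact: sub0set.
  by rewrite setD0; move: lam l2 N0 => l l2 n0; nra.
rewrite mainE -(avg_count_embeddings eT).
have deg0 x : x \in set0 -> (deg set0 x)%:R <= 0 :> R by rewrite inE.
have := avg_count_tree_le (R := R) (e := e) hT V_gt0 (lexx 0) deg0 cT.
rewrite cards0 mul0r avg_count_embeddings => le0.
have -> : nT set0 = 0 by apply/eqP; rewrite eq_le le0 ler0n.
rewrite sub0r normrN gtr0_norm //; move: (N * D ^+ r) lam M0 l2 => M l m0 l2.
by nra.
Qed.

Let count_error (E' : {set V}) (Delta : R) : E' \subset E -> 0 <= Delta ->
  (forall x, x \in E' -> (deg E' x)%:R <= Delta) ->
  `|nT E' - #|E'|%:R * (#|E'|%:R / q%:R) ^+ r| <=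
    2 * N * D * sig ^+ r.+1 * \sum_(j < r) (#|E'|%:R / q%:R) ^+ (r.-1 - j) * Delta ^+ j.
Proof.
move=> sE De0 degE; have a0 : 0 <= #|E'|%:R / q%:R :> R by rewrite divr_ge0 ?ler0n.
rewrite -avg_count_embeddings; apply: le_trans (avg_count_tree hT e_sym V_gt0 De0 degE a0 cT) _.
rewrite ler_wpM2r ?deviation //; apply: sumr_ge0 => j _.
by rewrite mulr_ge0 ?exprn_ge0.
Qed.

(** The error sum is empty or reduces to the term j = 0, which does not involve the maximal degree,
    so the trivial degree bound [N] serves and nothing is removed. *)
Lemma good_subset_small : (r <= 1)%N -> good_subset E.
Proof.
move=> r1; split=> //.
  rewrite setDv cards0; by apply: ltW; rewrite !(mulr_gt0, exprn_gt0, invr_gt0, addr_gt0, ltr0n).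
have degE x : x \in E -> (deg E x)%:R <= N.
  move=> _; rewrite ler_nat subset_leq_card //.
  by apply/subsetP => y; rewrite inE => /andP[].
have := count_error (subxx E) (ltW N0) degE; rewrite mainE => h; apply: le_trans h _.
have nd : 0 <= N * D * sig ^+ 2
  by apply: ltW; rewrite !(mulr_gt0, exprn_gt0, invr_gt0, addr_gt0, ltr0n).
move: r1 M0 X_lt cT; case: (r) => [|[|//]] _ _ _ _.
  rewrite big_ord0 mulr0 expr0 mulr1; by apply: ltW; rewrite !(mulr_gt0, exprn_gt0, invr_gt0, addr_gt0, ltr0n).
rewrite big_ord1 /= expr0 mulr1 mulr1 expr1.
by move: (N) (D) (sig ^+ 2) nd => n' d' l nd; nra.
Qed.

Section LongTree.
Variable k : nat.
Hypotheses (rk : r = k.+2) (lam_lt : lam < 1 / 2).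

(** [mu] is the fraction 4 sig^(2 (r+1)) / delta^2 that Chebyshev's inequality allows above the
    degree threshold (1 + delta) D. *)
Let delta : R := 3 * lam / k.+2%:R.
Let mu : R := 4 * k.+2%:R ^+ 2 / 9 * lam ^+ k.+1.
Let E1 : {set V} := [set x in E | (deg E x)%:R <= (1 + delta) * D].

Let lam0 : 0 < lam. Proof. exact: exprn_gt0. Qed.
Let k0 : 0 < k.+2%:R :> R. Proof. by rewrite ltr0n. Qed.
Let delta0 : 0 < delta. Proof. by rewrite divr_gt0 // mulr_gt0 // ltr0n. Qed.
Let mu_le : mu <= 2 * lam. Proof. by apply: removed_fraction; rewrite (ltW lam0) ltW. Qed.
Let mu_ge0 : 0 <= mu.
Proof. by rewrite mulr_ge0 ?divr_ge0 ?mulr_ge0 ?exprn_ge0 ?ler0n // ltW. Qed.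
Let E1_sub : E1 \subset E.
Proof. by apply/subsetP => x; rewrite inE => /andP[]. Qed.

Let removed_le : #|E :\: E1|%:R <= mu * N.
Proof.
have : \sum_(x in E :\: E1) (delta * N) ^+ 2 <= 4 * X * N.
  apply: le_trans (discrepancy E); rewrite [leRHS](bigID (mem (E :\: E1))) /=.
  apply: (@le_trans _ _ (\sum_(x in E :\: E1) (q%:R * (deg E x)%:R - N) ^+ 2)); last first.
    by rewrite lerDl; apply: sumr_ge0 => x _; apply: sqr_ge0.
  apply: ler_sum => x; rewrite !inE => /andP[+ xE]; rewrite xE /= -ltNge => hx.
  have dN : 0 <= delta * N by apply: ltW; rewrite !(mulr_gt0, exprn_gt0, invr_gt0, addr_gt0, ltr0n).
  have lt : delta * N < q%:R * (deg E x)%:R - N.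
    rewrite ltrBrDr; apply: le_lt_trans (_ : q%:R * ((1 + delta) * D) < _).
      by rewrite le_eqVlt; apply/orP; left; apply/eqP; field; rewrite gt_eqF.
    by rewrite ltr_pM2l.
  by rewrite lerXn2r ?nnegrE ?(ltW lt) // (le_trans dN) // ltW.
rewrite sumr_const -[_ *+ #|_|]mulr_natl => h.
have {}h : #|E :\: E1|%:R * delta ^+ 2 <= 4 * (sig ^+ (r.+1).*2) * N.
  have N2 : 0 < N ^+ 2 by rewrite exprn_gt0.
  rewrite -(ler_pM2r N2).
  have -> : #|E :\: E1|%:R * delta ^+ 2 * N ^+ 2 = #|E :\: E1|%:R * (delta * N) ^+ 2 by ring.
  apply: le_trans h _.
  have -> : 4 * sig ^+ (r.+1).*2 * N * N ^+ 2 = 4 * (sig ^+ (r.+1).*2 * N ^+ 2) * N by ring.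
  by rewrite ler_pM2r // ler_pM2l ?ltr0n // ltW.
have sE : sig ^+ (r.+1).*2 = lam ^+ 2 * lam ^+ k.+1.
  by rewrite rk -muln2 mulnC exprM -exprD.
have d2 : 0 < delta ^+ 2 by rewrite exprn_gt0.
rewrite -(ler_pM2r d2); apply: le_trans h _; rewrite sE.
rewrite le_eqVlt; apply/orP; left; apply/eqP.
rewrite /mu /delta; move: (lam ^+ k.+1) => L; move: (k.+2%:R : R) k0 => m m0.
by field; rewrite gt_eqF.
Qed.

Let E1_card : (1 - mu) * N <= #|E1|%:R.
Proof.
have cE : N = #|E1|%:R + #|E :\: E1|%:R.
  by rewrite -natrD -(cardsID E1 E) (setIidPr E1_sub).
by have := removed_le; rewrite mulrBl mul1r {2}cE; lra.
Qed.

Let degE1 x : x \in E1 -> (deg E1 x)%:R <= (1 + delta) * D.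
Proof.
rewrite inE => /andP[_]; apply: le_trans; rewrite ler_nat subset_leq_card //.
by apply/subsetP => y; rewrite !inE => /andP[/andP[-> _] ->].
Qed.

Let Delta_ge0 : 0 <= (1 + delta) * D.
Proof. by apply: ltW; rewrite !(mulr_gt0, exprn_gt0, invr_gt0, addr_gt0, ltr0n). Qed.

Let E1_le : #|E1|%:R <= N.
Proof. by rewrite ler_nat subset_leq_card. Qed.

Let upper : nT E1 <= N * D ^+ r * (1 + 8 * lam).
Proof.
have := avg_count_tree_le hT V_gt0 Delta_ge0 degE1 cT.
rewrite avg_count_embeddings => h; apply: le_trans h _.
rewrite exprMn [(1 + delta) ^+ r * _]mulrC mulrA; apply: ler_pM.
- by rewrite mulr_ge0 ?ler0n // exprn_ge0 // ltW.
- by apply: ltW; rewrite !(mulr_gt0, exprn_gt0, invr_gt0, addr_gt0, ltr0n).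
- by rewrite ler_wpM2r ?exprn_ge0 // ltW.
by rewrite rk; apply: upper_factor; rewrite (ltW lam0) ltW.
Qed.

Let lower : N * D ^+ r * (1 - 8 * lam) <= nT E1.
Proof.
(* For larger lam the left-hand side is not positive. *)
have [l8|l8] := leP lam (1 / 8); last first.
  apply: (@le_trans _ _ 0); last exact: ler0n.
  by rewrite pmulr_rle0 //; lra.
have := count_error E1_sub Delta_ge0 degE1; rewrite ler_norml => /andP[h _].
set a : R := #|E1|%:R / q%:R in h.
have a0 : 0 <= a by rewrite divr_ge0 ?ler0n.
have aD : a <= D by rewrite ler_wpM2r // invr_ge0 ltW.
have aDelta : a <= (1 + delta) * D.
  by apply: le_trans aD _; rewrite ler_peMl ?(ltW D0) // lerDl ltW.
have sum_le : \sum_(j < r) a ^+ (r.-1 - j) * ((1 + delta) * D) ^+ j <=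
    k.+2%:R * (8 / 5) * D ^+ k.+1.
  apply: (@le_trans _ _ (\sum_(j < r) ((1 + delta) * D) ^+ k.+1)).
    apply: ler_sum => j _.
    have jr : (j <= r.-1)%N by rewrite -ltnS prednK ?ltn_ord // rk.
    have -> : k.+1 = (r.-1 - j + j)%N by rewrite subnK // rk.
    by rewrite exprD ler_wpM2r ?exprn_ge0 // lerXn2r ?nnegrE.
  rewrite sumr_const card_ord rk -[_ *+ k.+2]mulr_natl -mulrA ler_pM2l // exprMn.
  rewrite ler_pM2r ?exprn_gt0 //.
  have l0 : 0 <= lam <= 1 / 8 by rewrite (ltW lam0).
  apply: le_trans (upper_factor_small k.+1 l0).
  by rewrite [leRHS]exprS ler_peMl ?lerDl ?exprn_ge0 ?addr_ge0 ?ltW.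
have mu1 : 0 <= mu <= 1 by rewrite mu_ge0 (le_trans mu_le) //; lra.
have mu' : 0 <= 1 - mu by rewrite subr_ge0; case/andP: mu1.
(* The size of [E1] occurs r + 1 = k + 3 times, each time at least (1 - mu) N; Bernoulli's
   inequality makes the loss linear. *)
have main : N * D ^+ r * (1 - k.+3%:R * mu) <= #|E1|%:R * a ^+ r.
  apply: (@le_trans _ _ (((1 - mu) * N) * ((1 - mu) * D) ^+ r)).
    have -> : (1 - mu) * N * ((1 - mu) * D) ^+ r = N * D ^+ r * (1 - mu) ^+ r.+1.
      by rewrite exprMn exprS; ring.
    by rewrite ler_pM2l // rk bernoulli_ineq.
  have aD' : (1 - mu) * D <= a by rewrite mulrA ler_wpM2r // invr_ge0 ltW.
  have muN : 0 <= (1 - mu) * N by apply: mulr_ge0 => //; apply: ltW.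
  have muD : 0 <= (1 - mu) * D by apply: mulr_ge0 => //; apply: ltW.
  by rewrite ler_pM ?exprn_ge0 // lerXn2r ?nnegrE.
have err : 2 * N * D * sig ^+ r.+1 * \sum_(j < r) a ^+ (r.-1 - j) * ((1 + delta) * D) ^+ j <=
    N * D ^+ r * (2 * k.+2%:R * sig ^+ k.+3 * (8 / 5)).
  have c0 : 0 <= 2 * N * D * sig ^+ r.+1.
    by apply: ltW; rewrite !(mulr_gt0, exprn_gt0, invr_gt0, addr_gt0, ltr0n).
  apply: le_trans (ler_wpM2l c0 sum_le) _; rewrite rk [D ^+ k.+2]exprS.
  by rewrite le_eqVlt; apply/orP; left; apply/eqP; ring.
have := lower_error k (ltW sig_gt0) l8; rewrite -/mu => num.
have num' : N * D ^+ r * (k.+3%:R * mu + 2 * k.+2%:R * sig ^+ k.+3 * (8 / 5)) <=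
    N * D ^+ r * (8 * lam) by rewrite ler_pM2l.
move: h main err num'; set Y := _ * \sum_(j < r) _; set Z := nT E1.
move: (N * D ^+ r) (#|E1|%:R * a ^+ r) => M W h1 h2 h3 h4.
by nra.
Qed.

Lemma good_subset_long : good_subset E1.
Proof.
split=> //; first by apply: le_trans removed_le _; rewrite ler_pM2r.
rewrite mainE ler_norml; move: lower upper; set Z := nT E1.
by move: (N * D ^+ r) => M h1 h2; apply/andP; split; lra.
Qed.

End LongTree.

Theorem exists_good_subset : exists E', good_subset E'.
Proof.
have [l2|l2] := leP (1 / 2) lam; first by exists set0; apply: good_subset_large.
have [r1|r2] := leqP r 1; first by exists E; apply: good_subset_small.
have rk : r = r.-2.+2 by case: (r) r2 => [|[]].
by eexists; apply: good_subset_long rk l2.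
Qed.

End EmbeddingCount.

Lemma sqnormN (F : finFieldType) (d : nat) (x : 'rV[F]_d) : sqnorm (- x) = sqnorm x.
Proof. by apply: eq_bigr => i _; rewrite mxE sqrrN. Qed.

Lemma embeddings_of_discrepancy (R : realType) (F : finFieldType) (d : nat)
    (E : {set 'rV[F]_d}) (r : nat) (T : finType) (eT : rel T) (e : rel 'rV[F]_d) (eps : R) :
  is_tree eT -> #|T| = r.+1 -> symmetric e ->
  (forall B : {set 'rV[F]_d},
     \sum_x ((#|F| * #|[set y in B | e x y]|)%:Z - #|B|%:Z) ^+ 2
       <= 4 * #|F|%:Z ^+ d.+1 * #|B|%:Z) ->
  #|F|%:R `^ ((d%:R + 1) / 2 + eps) < #|E|%:R :> R ->
  exists E' : {set 'rV[F]_d},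
    [/\ E' \subset E,
        #|E :\: E'|%:R <= 2 * #|F|%:R `^ (- (2 * eps / (r%:R + 1))) * #|E|%:R :> R
      & `| (num_embeddings eT (fun x y : {x | x \in E'} => e (val x) (val y)))%:R
           - #|E|%:R ^+ r.+1 / #|F|%:R ^+ r |
          <= 8 * (#|E|%:R ^+ r.+1 / #|F|%:R ^+ r) * #|F|%:R `^ (- (2 * eps / (r%:R + 1))) :> R].
Proof.
move=> hT cT e_sym disc hE; have q_gt0 : (0 < #|F|)%N := ltnW (card_finNzRing_gt1 F).
have q0 : 0 < #|F|%:R :> R by rewrite ltr0n.
(* The square of [sig] is the saving in the conclusion, and its power r + 1 is q^(-eps), the
   relative size of the degree deviation. *)
pose sig : R := #|F|%:R `^ (- (eps / (r%:R + 1))).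
have r1 : r%:R + 1 = r.+1%:R :> R by rewrite natr1.
have sig_gt0 : 0 < sig by apply: powR_gt0.
have sigX n : sig ^+ n = #|F|%:R `^ (- (n%:R * eps / (r%:R + 1))).
  by rewrite -powR_mulrn ?powR_ge0 // -powRrM; congr (_ `^ _); rewrite mulNr mulrAC [n%:R * _]mulrC.
have E_gt0 : (0 < #|E|)%N by rewrite -(ltr0n R); apply: le_lt_trans (powR_ge0 _ _) hE.
(* This is the square of the hypothesis on the size of [E], divided by q^(2 eps). *)
have X_lt : #|F|%:R ^+ d.+1 < sig ^+ (r.+1).*2 * #|E|%:R ^+ 2.
  have -> : sig ^+ (r.+1).*2 = #|F|%:R `^ (- (2 * eps)).
    rewrite sigX -muln2 natrM r1; congr (_ `^ - _).
    have : (r.+1%:R : R) != 0 by rewrite pnatr_eq0.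
    by move: (r.+1%:R : R) => m m0; field.
  rewrite powRN mulrC ltr_pdivlMr ?powR_gt0 //.
  apply: le_lt_trans (_ : (#|F|%:R `^ ((d%:R + 1) / 2 + eps)) ^+ 2 < _); last first.
    by rewrite ltrXn2r ?powR_ge0.
  rewrite -powR_mulrn ?powR_ge0 // -powRrM -powR_mulrn ?ler0n // -powRD; last first.
    by rewrite [X in _ ==> ~~ X]gt_eqF ?implybT.
  by rewrite le_eqVlt; apply/orP; left; apply/eqP; congr (_ `^ _); rewrite -natr1; field.
have discR (B : {set 'rV[F]_d}) :
    \sum_x (#|F|%:R * #|[set y in B | e x y]|%:R - #|B|%:R) ^+ 2
      <= 4 * #|F|%:R ^+ d.+1 * #|B|%:R :> R.
  have := disc B; rewrite -(ler_int R) rmorph_sum !rmorphM rmorphXn /=; apply: le_trans.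
  rewrite le_eqVlt; apply/orP; left; apply/eqP; apply: eq_bigr => x _.
  by rewrite rmorphXn rmorphB /= -natrM.
have [E' [sub card_le count_le]] := exists_good_subset hT cT e_sym q_gt0 discR sig_gt0 E_gt0 X_lt.
by exists E'; split; rewrite // -sigX.
Qed.

Theorem theorem1p4 (R : realType) (F : finFieldType) (q : nat)
    (hq : #|F| = q) (d : nat) (hd : (2 <= d)%N) (t : F) (ht : t != 0)
    (E : {set 'rV[F]_d}) (r : nat) (T : finType) (eT : rel T)
    (hT : is_tree eT) (hr : #|T| = r.+1) (eps : R) (heps : 0 < eps)
    (hE : q%:R `^ ((d%:R + 1) / 2 + eps) < #|E|%:R :> R) :
  (odd q ->
   exists E' : {set 'rV[F]_d},
     [/\ E' \subset E,
         #|E :\: E'|%:R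
           <= 2 * q%:R `^ (- (2 * eps / (r%:R + 1))) * #|E|%:R :> R
       & `| (num_embeddings eT (@dist_graph F d t E'))%:R
            - #|E|%:R ^+ r.+1 / q%:R ^+ r |
           <= 8 * (#|E|%:R ^+ r.+1 / q%:R ^+ r)
              * q%:R `^ (- (2 * eps / (r%:R + 1))) :> R])
  /\
  (exists E' : {set 'rV[F]_d},
     [/\ E' \subset E,
         #|E :\: E'|%:R
           <= 2 * q%:R `^ (- (2 * eps / (r%:R + 1))) * #|E|%:R :> R
       & `| (num_embeddings eT (@prod_graph F d t E'))%:R
            - #|E|%:R ^+ r.+1 / q%:R ^+ r |
           <= 8 * (#|E|%:R ^+ r.+1 / q%:R ^+ r)
              * q%:R `^ (- (2 * eps / (r%:R + 1))) :> R]).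
Proof.
subst q; split=> [oddF|].
  apply: (@embeddings_of_discrepancy R F d E r T eT (fun x y => sqnorm (x - y) == t)) => //.
    by move=> x y; rewrite -opprB sqnormN.
  exact: dist_discrepancy.
apply: (@embeddings_of_discrepancy R F d E r T eT (fun x y => dotprod x y == t)) => //.
  by move=> x y; rewrite dotprodC.
exact: prod_discrepancy.
Qed.
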